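(* In the setting of the context, let $W$ satisfy the boundary conditions $$W=0\ \text{on }\Gamma_w,\qquad \mathbf v\cdot\mathbf n_f^{\pm}=-q^{\pm}(u,v)\ \text{on }\Gamma_f^{\pm},\qquad \mathbf v\cdot\mathbf n=0\ \text{on }\Gamma_{f_{out}}\cup\Gamma_{out}^{\pm},$$ where $\mathbf v=-f_\beta(\|\nabla_GW\|_G)\nabla_GW$, and the thickness-integrated flow equation $$-\frac{Q}{|\Omega|}\int_{-h}^{h}\sqrt{|G|}\,d\lambda=\int_{-h}^{h}\Big[\sum_{i,j=1}^{2}\partial_i\big(f_\beta(\|\nabla_GW\|_G)\sqrt{|G|}\,G^{ij}\partial_jW\big)+\partial_\lambda\big(f_\beta(\|\nabla_GW\|_G)\sqrt{|G|}\,\partial_\lambda W\big)\Big]d\lambda ,$$ with $h=h(u,v)$. Then this equation reduces to $$-\sum_{i,j=1}^{2}\partial_i\int_{-h(u,v)}^{h(u,v)}\big(f_\beta(\|\nabla_GW\|_G)\sqrt{|G|}\,G^{ij}\partial_jW\big)\,d\lambda=\frac{Q}{|\Omega|}\int_{-h(u,v)}^{h(u,v)}\sqrt{|G|}\,d\lambda+\tilde q^+(u,v)+\tilde q^-(u,v),$$ where $$\tilde q^{\pm}(u,v)=q^{\pm}\sqrt{1+h_u^2+h_v^2}\,\sqrt{|G|}\,\Big|_{\lambda=\pm h(u,v)} .$$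
   Context: Geometry. $\mathbf r(u,v)$, $0\le u\le L$, $a\le v\le b$, is a smooth surface immersed in $\mathbb R^3$ with unit normal $\mathbf n(u,v)=\frac{\mathbf r_u\times\mathbf r_v}{\|\mathbf r_u\times\mathbf r_v\|}$, and $h(u,v)>0$ is a smooth function. The fracture is $\mathbf R(u,v,\lambda)=\mathbf r(u,v)+\lambda\,\mathbf n(u,v)$, $-h(u,v)\le\lambda\le h(u,v)$, assumed to be an immersion. $G=[G_{ij}]$ is the induced metric, $G_{ij}=\langle\partial_i\mathbf R,\partial_j\mathbf R\rangle$, with $\partial_1=\partial_u,\partial_2=\partial_v,\partial_3=\partial_\lambda$; $|G|=\det G$, $G^{-1}=[G^{ij}]$. One has $G_{13}=G_{23}=0$, $G_{33}=1$. In coordinates: $\Omega_f=\{0<u<L,\ a<v<b,\ -h(u,v)<\lambda<h(u,v)\}$; $\Gamma_w$ is the part of $\partial\Omega_f$ with $u=0$; $\Gamma_f^\pm$ the part with $\lambda=\pm h(u,v)$; $\Gamma_{f_{out}}$ the part with $u=L$; $\Gamma_{out}^+$, $\Gamma_{out}^-$ the parts with $v=b$, $v=a$. Operators. $(\nabla_G\phi)^j=\sum_{i=1}^3G^{ij}\partial_i\phi$, $\|\nabla_G\phi\|_G^2=\sum_{i,j=1}^3G^{ij}\partial_i\phi\,\partial_j\phi$. $f_\beta(s)=\dfrac{2}{\alpha+\sqrt{\alpha^2+4\beta s}}$ with constants $\alpha>0,\beta\ge0$. Normals. In boundary conditions, $\mathbf v\cdot\mathbf n$ is the dot product of the coordinate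 components $(v^1,v^2,v^3)$ in $(u,v,\lambda)$-coordinates with the unit outward normal in $(u,v,\lambda)$-space; in particular $\mathbf n_f^{\pm}=\frac{\langle -h_u,-h_v,\pm1\rangle}{\sqrt{1+h_u^2+h_v^2}}$ on $\Gamma_f^\pm$. $Q$ and $|\Omega|>0$ are constants, $q^\pm(u,v)$ are given functions; $W$ and its gradient are $C^2$ on $\overline{\Omega_f}$. *)

(* Defs.v *)
From mathcomp Require Export all_boot all_order all_algebra.
From mathcomp Require Export all_classical all_reals all_analysis.
Export Order.TTheory GRing.Theory Num.Theory.
Export numFieldNormedType.Exports.

Set Implicit Arguments.
Unset Strict Implicit.
Unset Printing Implicit Defensive.

Local Open Scope classical_set_scope.
Local Open Scope ring_scope.

Section EuclideanSpace.
Context {R : realType}.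

(* The norm `|v| of 'rV is the sup norm, hence the separate Euclidean norm. *)
Definition dot n (u v : 'rV[R]_n) : R := \sum_k u 0 k * v 0 k.

Definition enorm n (v : 'rV[R]_n) : R := Num.sqrt (dot v v).

Definition row3 (x y z : R) : 'rV[R]_3 := \row_k [:: x; y; z]`_k.

Definition cross (u v : 'rV[R]_3) : 'rV[R]_3 :=
  row3 (u 0 1 * v 0 2 - u 0 2 * v 0 1)
       (u 0 2 * v 0 0 - u 0 0 * v 0 2)
       (u 0 0 * v 0 1 - u 0 1 * v 0 0).

End EuclideanSpace.

Section UpToTheBoundary.
Context {R : realType} {n : nat} {V : normedModType R}.
Implicit Types (A : set 'rV[R]_n.+1) (f : 'rV[R]_n.+1 -> V).

(* A is an open set.  [pd A i f] is the i-th partial derivative of f on the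
   closure of A: the value at a boundary point is the limit of the values taken
   inside A.  For f of class C^1 on the closure (see [Ck]) it is the ordinary
   partial derivative on A, and it does not depend on f outside closure A. *)
Definition pd A (i : 'I_n.+1) f (x : 'rV[R]_n.+1) : V :=
  lim ('D_(delta_mx 0 i) f y @[y --> within A (nbhs x)]).

(* Class C^k on the closure of A: f is C^k on A, and f and its partial
   derivatives of order at most k extend continuously to the closure (f itself
   being given there). *)
Fixpoint Ck A (k : nat) f : Prop :=
  {within closure A, continuous f} /\
  if k is k'.+1 then
    forall i : 'I_n.+1,
      (forall x, A x -> derivable f x (delta_mx 0 i) /\
                        'D_(delta_mx 0 i) f x = pd A i f x) /\
      Ck A k' (pd A i f)
  else True.

Definition smooth A f : Prop := forall k, Ck A k f.

End UpToTheBoundary.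

Section Geometry.
Context {R : realType}.

Definition jacobian n m (A : set 'rV[R]_n.+1)
    (X : 'rV[R]_n.+1 -> 'rV[R]_m.+1) (x : 'rV[R]_n.+1) : 'M[R]_(n.+1, m.+1) :=
  \matrix_i pd A i X x.

(* Injectivity of the differential: linear independence of the partials. *)
Definition immersed n m (A : set 'rV[R]_n.+1)
    (X : 'rV[R]_n.+1 -> 'rV[R]_m.+1) : Prop :=
  forall x, closure A x -> row_free (jacobian A X x).

Definition point (p : 'rV[R]_2) (lambda : R) : 'rV[R]_3 :=
  row3 (p 0 0) (p 0 1) lambda.

Definition base (x : 'rV[R]_3) : 'rV[R]_2 := \row_(k < 2) x 0 (widen_ord (leqnSn 2) k).

Definition rectangle (L a b : R) : set 'rV[R]_2 :=
  [set p | 0 < p 0 0 < L /\ a < p 0 1 < b].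

Definition unit_normal (D : set 'rV[R]_2) (r : 'rV[R]_2 -> 'rV[R]_3)
    (p : 'rV[R]_2) : 'rV[R]_3 :=
  let w := cross (pd D 0 r p) (pd D 1 r p) in (enorm w)^-1 *: w.

Definition Omega_f (D : set 'rV[R]_2) (h : 'rV[R]_2 -> R) : set 'rV[R]_3 :=
  [set x | D (base x) /\ - h (base x) < x 0 2 < h (base x)].

Definition fracture (D : set 'rV[R]_2) (r : 'rV[R]_2 -> 'rV[R]_3)
    (x : 'rV[R]_3) : 'rV[R]_3 :=
  r (base x) + x 0 2 *: unit_normal D r (base x).

Definition boundary (O : set 'rV[R]_3) : set 'rV[R]_3 := closure O `\` interior O.

Definition area_factor (D : set 'rV[R]_2) (h : 'rV[R]_2 -> R) (p : 'rV[R]_2) : R :=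
  Num.sqrt (1 + pd D 0 h p ^+ 2 + pd D 1 h p ^+ 2).

(* Unit outward normal, in coordinate space, of the face lambda = s * h(u, v),
   for s = 1 or s = -1. *)
Definition face_normal (D : set 'rV[R]_2) (h : 'rV[R]_2 -> R) (s : R)
    (p : 'rV[R]_2) : 'rV[R]_3 :=
  (area_factor D h p)^-1 *: row3 (- pd D 0 h p) (- pd D 1 h p) s.

End Geometry.

Section Flow.
Context {R : realType}.
Variables (O : set 'rV[R]_3) (X : 'rV[R]_3 -> 'rV[R]_3).

Definition metric (x : 'rV[R]_3) : 'M[R]_3 :=
  \matrix_(i, j) dot (pd O i X x) (pd O j X x).

Definition sqrt_det (x : 'rV[R]_3) : R := Num.sqrt (\det (metric x)).

Definition gradG (phi : 'rV[R]_3 -> R) (x : 'rV[R]_3) : 'rV[R]_3 :=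
  \row_j \sum_i invmx (metric x) i j * pd O i phi x.

Definition normG_grad (phi : 'rV[R]_3 -> R) (x : 'rV[R]_3) : R :=
  Num.sqrt (\sum_i \sum_j invmx (metric x) i j * pd O i phi x * pd O j phi x).

Definition f_beta (alpha beta s : R) : R :=
  2 / (alpha + Num.sqrt (alpha ^+ 2 + 4 * beta * s)).

Variables (alpha beta : R) (W : 'rV[R]_3 -> R).

Definition velocity (x : 'rV[R]_3) : 'rV[R]_3 :=
  - (f_beta alpha beta (normG_grad W x) *: gradG W x).

Definition tangential_flux (i j : 'I_2) (x : 'rV[R]_3) : R :=
  let i3 := widen_ord (leqnSn 2) i in
  let j3 := widen_ord (leqnSn 2) j in
  f_beta alpha beta (normG_grad W x) * sqrt_det x
    * invmx (metric x) i3 j3 * pd O j3 W x.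

Definition transversal_flux (x : 'rV[R]_3) : R :=
  f_beta alpha beta (normG_grad W x) * sqrt_det x * pd O 2 W x.

Definition flux_divergence (x : 'rV[R]_3) : R :=
  (\sum_(i < 2) \sum_(j < 2)
     pd O (widen_ord (leqnSn 2) i) (tangential_flux i j) x)
    + pd O 2 transversal_flux x.

End Flow.

Section Thickness.
Context {R : realType}.

Definition thickness_integral (h : 'rV[R]_2 -> R) (F : 'rV[R]_3 -> R)
    (p : 'rV[R]_2) : R :=
  \int[lebesgue_measure]_(l in `[- h p, h p]) F (point p l).

End Thickness.

(* Main.v *)
Require Import Defs.
From mathcomp Require Import ring lra.

(* By the Leibniz rule, differentiating the integral of a tangential flux over
   [-h, h] produces the integral of its derivative plus the boundary terms
   h_i (F(h) + F(-h)), while the fundamental theorem of calculus integrates the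
   transversal term of the flow equation to T(h) - T(-h).  Since the third row of
   G^-1 is (0, 0, 1), the boundary terms combine on each face into
   sqrt|G| sqrt(1 + h_u^2 + h_v^2) times the normal velocity, that is, into
   -q~^+ and -q~^-.
   The fluxes are C^1 up to the faces even where grad W = 0, because
   f(|y|) y is C^1 in y although |y| is not. *)

Set Implicit Arguments.
Unset Strict Implicit.
Unset Printing Implicit Defensive.

Local Open Scope classical_set_scope.
Local Open Scope ring_scope.


(** * Functions of class C^k up to part of the boundary *)

(** On the faces the fluxes are known only as limits from inside, and no extension across the faces
    is assumed. Hence [F(p, h(p))] cannot be differentiated as a composite, and the usual Leibniz
    rule, which asks for [F] beyond the moving end points, does not apply directly. Rescaling the
    height to [l = h t] keeps every evaluation with [|t| < 1] in the open region, where ordinary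
    partial derivatives exist; the faces enter only through continuity at [t = 1] and [t = -1].
    Partial derivatives are given direction by direction, without a total differential, so chain
    rules are proved along lines. To turn [sum G^ij W_i W_j] into a Euclidean norm, the Jacobian [J]
    of the fracture serves as a square root of [G = J J^T]: the entries of [J^-1] are rational in
    those of [J], so [y = J^-1 grad W] inherits regularity from [J] and [grad W]. *)

Lemma cvg_line {R : realType} (V : normedModType R) (x v : V) :
  (h *: v + x) @[h --> (0 : R)^'] --> x.
Proof.
apply: cvg_within_filter.
have : (h *: v + x) @[h --> (0 : R)] --> 0 *: v + x.
  by apply: cvgD; [apply: cvgZ; [exact: cvg_id|exact: cvg_cst]|exact: cvg_cst].
by rewrite scale0r add0r.
Qed.

Section UpTo.
Context {R : realType} {n : nat}.
Notation T := 'rV[R]_n.+1.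
Notation e_ i := (delta_mx 0 i : T).
Variables (O K : set T).

(* [K] is meant to satisfy O `<=` K `<=` closure O.  The values of [f] outside [K]
   are irrelevant, and the derivatives on [O] are required to extend continuously
   to [K] only, not to the whole closure of [O]. *)
Fixpoint cdiff (k : nat) (f : T -> R) : Prop :=
  {within K, continuous f} /\
  if k is k'.+1 then
    exists g : 'I_n.+1 -> T -> R, forall i,
      (forall x, O x -> is_derive x (e_ i) f (g i x)) /\ cdiff k' (g i)
  else True.

Lemma cdiff_continuous k f : cdiff k f -> {within K, continuous f}.
Proof. by case: k => [|k] []. Qed.

Lemma cdiffW k f : cdiff k.+1 f -> cdiff k f.
Proof.
elim: k f => [|k IH] f [cf [g dg]]; first by split.
by split=> //; exists g => i; have [? ?] := dg i; split=> //; exact: IH.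
Qed.

Lemma cdiff_cst k (c : R) : cdiff k (fun=> c).
Proof.
elim: k c => [|k IH] c; (split; first by apply: continuous_subspaceT => x; exact: cst_continuous) => //.
by exists (fun _ _ => 0) => i; split=> // x _; exact: is_derive_cst.
Qed.

Lemma cdiffD k f g : cdiff k f -> cdiff k g -> cdiff k (fun x => f x + g x).
Proof.
elim: k f g => [|k IH] f g [cf Hf] [cg Hg];
  (split; first by move=> x; apply: continuousD; [exact: cf|exact: cg]) => //.
have [f' df] := Hf; have [g' dg] := Hg.
exists (fun i x => f' i x + g' i x) => i.
have [dfi cfi] := df i; have [dgi cgi] := dg i.
split; last exact: IH.
by move=> x Ox; apply: is_deriveD; [exact: dfi|exact: dgi].
Qed.

Lemma cdiffM k f g : cdiff k f -> cdiff k g -> cdiff k (fun x => f x * g x).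
Proof.
elim: k f g => [|k IH] f g Hf Hg;
  have cf := cdiff_continuous Hf; have cg := cdiff_continuous Hg;
  (split; first by move=> x; apply: continuousM; [exact: cf|exact: cg]) => //.
have [_ [f' df]] := Hf; have [_ [g' dg]] := Hg.
exists (fun i x => f x * g' i x + g x * f' i x) => i.
have [dfi cfi] := df i; have [dgi cgi] := dg i.
split; last by apply: cdiffD; apply: IH => //; exact: cdiffW.
by move=> x Ox; apply: is_deriveM; [exact: dfi|exact: dgi].
Qed.

Lemma cdiffN k f : cdiff k f -> cdiff k (fun x => - f x).
Proof.
move=> Hf; rewrite (_ : (fun x => _) = (fun x => (-1) * f x)); last first.
  by apply/funext => x; rewrite mulN1r.
by apply: cdiffM => //; exact: cdiff_cst.
Qed.

Lemma cdiffB k f g : cdiff k f -> cdiff k g -> cdiff k (fun x => f x - g x).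
Proof. by move=> Hf Hg; apply: cdiffD => //; exact: cdiffN. Qed.

Lemma cdiff_sum k (I : Type) (r : seq I) (P : pred I) (F : I -> T -> R) :
  (forall i, P i -> cdiff k (F i)) ->
  cdiff k (fun x => \sum_(i <- r | P i) F i x).
Proof.
move=> HF; elim: r => [|i r IH].
  rewrite (_ : (fun _ => _) = cst 0); first exact: cdiff_cst.
  by apply/funext => x; rewrite big_nil.
have [Pi|Pi] := boolP (P i); last first.
  by under eq_fun do rewrite big_cons (negbTE Pi).
under eq_fun do rewrite big_cons Pi.
apply: cdiffD => //; exact: HF.
Qed.

Lemma cdiff_prod k (I : Type) (r : seq I) (P : pred I) (F : I -> T -> R) :
  (forall i, P i -> cdiff k (F i)) ->
  cdiff k (fun x => \prod_(i <- r | P i) F i x).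
Proof.
move=> HF; elim: r => [|i r IH].
  rewrite (_ : (fun _ => _) = cst 1); first exact: cdiff_cst.
  by apply/funext => x; rewrite big_nil.
have [Pi|Pi] := boolP (P i); last first.
  by under eq_fun do rewrite big_cons (negbTE Pi).
under eq_fun do rewrite big_cons Pi.
apply: cdiffM => //; exact: HF.
Qed.

Lemma is_derive_coord (i j : 'I_n.+1) x : is_derive x (e_ i) (fun x : T => x 0 j) (i == j)%:R.
Proof.
have dx : derivable (fun x : T => x 0 j) x (e_ i).
  by move: (@derivable_id R _ x (e_ i)) => /derivable_mxP; apply.
apply: DeriveDef => //.
have := derive_mx (@derivable_id R _ x (e_ i)).
rewrite derive_id => /matrixP/(_ 0 j); rewrite !mxE => <-.
by rewrite eq_sym.
Qed.

Lemma cdiff_coord k (j : 'I_n.+1) : cdiff k (fun x => x 0 j).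
Proof.
case: k => [|k]; (split; first by
  apply: continuous_subspaceT => x; exact: coord_continuous) => //.
exists (fun i _ => (i == j)%:R) => i; split; last exact: cdiff_cst.
by move=> x _; exact: is_derive_coord.
Qed.

Hypothesis oO : open O.
Hypothesis OK : O `<=` K.

Lemma within_eq (V : topologicalType) (f g : T -> V) : (forall x, K x -> f x = g x) ->
  {within K, continuous f} -> {within K, continuous g}.
Proof.
by move=> fg; apply: subspace_eq_continuous => x /set_mem Kx; rewrite /from_subspace fg.
Qed.

(** Derivatives are taken only at points of the open set [O], near which [f] and [g] coincide. This
    allows formulas valid on [K] only, such as those for an inverse matrix, to replace the original
    functions. *)
Lemma cdiff_eq k f g : (forall x, K x -> f x = g x) -> cdiff k f -> cdiff k g.
Proof.
move=> fg; case: k => [|k] [cf Hf]; (split; first exact: (within_eq fg)) => //.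
have [f' df] := Hf; exists f' => i; have [dfi cfi] := df i; split=> // x Ox.
apply: near_eq_is_derive (dfi x Ox).
have : \forall y \near x, O y by exact: open_nbhs_nbhs.
by apply: filterS => y Oy; rewrite fg//; exact: OK.
Qed.

Lemma cdiffV k f : (forall x, K x -> f x != 0) -> cdiff k f ->
  cdiff k (fun x => (f x)^-1).
Proof.
move=> f0; elim: k f f0 => [|k IH] f f0 Hf; (split;
  first by apply/subspace_continuousP => x Kx;
    apply: cvgV; [exact: f0|move: (x) (Kx); apply/subspace_continuousP; exact: cdiff_continuous Hf]) => //.
have [_ [f' df]] := Hf.
exists (fun i x => - ((f x)^-1 * (f x)^-1 * f' i x)) => i.
have [dfi cfi] := df i; split; last first.
  apply: cdiffN; apply: cdiffM => //.
  by apply: cdiffM; apply: IH => //; exact: cdiffW.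
move=> x Ox; have [dx <-] := dfi x Ox.
apply: DeriveDef; first by apply: derivableV => //; exact/f0/OK.
rewrite deriveV //; last exact/f0/OK.
by rewrite scaleNr expr2 invfM.
Qed.

(** Only a directional derivative of [f] is given, so the statement is pulled back to the line
    [h |-> h *: v + x], where the one-variable chain rule applies. *)
Lemma is_derive_comp (phi : R -> R) (f : T -> R) x v a b :
  is_derive (f x) 1 phi a -> is_derive x v f b ->
  is_derive x v (fun y => phi (f y)) (a * b).
Proof.
move=> dphi [df dfE].
have E (g : T -> R) : 'D_v g x = 'D_1 (fun h : R => g (h *: v + x)) 0.
  rewrite /derive; set g1 := fun h => h^-1 *: _; set g2 := fun h => h^-1 *: _.
  suff -> : g1 = g2 by [].
  by apply/funext => h; rewrite /g1 /g2/= addr0 scale0r add0r [_%:A]mulr1.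
have d0 : is_derive (0:R) 1 (fun h : R => f (h *: v + x)) b.
  by apply: DeriveDef; [exact: (derivable1P f x v).1 df|rewrite -E dfE].
have d1 : is_derive (0:R) 1 (phi \o (fun h : R => f (h *: v + x))) (a * b).
  by apply: (is_derive1_comp _ d0); rewrite /= scale0r add0r.
have [d1' d1E] := d1.
by apply: DeriveDef; [exact: (derivable1P _ x v).2 d1'|rewrite E].
Qed.

Lemma cdiff_sqrt k f : (forall x, K x -> 0 < f x) -> cdiff k f ->
  cdiff k (fun x => Num.sqrt (f x)).
Proof.
move=> f0; elim: k f f0 => [|k IH] f f0 Hf; (split; first by
  move=> x; apply: continuous_comp; [exact: (cdiff_continuous Hf)|exact: sqrt_continuous]) => //.
have [_ [f' df]] := Hf.
exists (fun i x => (2 * Num.sqrt (f x))^-1 * f' i x) => i.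
have [dfi cfi] := df i; split; last first.
  apply: cdiffM => //; apply: cdiffV.
    by move=> x Kx; rewrite mulf_neq0// gt_eqF// sqrtr_gt0 f0.
  apply: cdiffM; first exact: cdiff_cst.
  by apply: IH => //; exact: cdiffW.
move=> x Ox; apply: is_derive_comp; last exact: dfi.
exact/is_derive1_sqrt/f0/OK.
Qed.

Lemma cdiff_det k m (A : T -> 'M[R]_m) :
  (forall i j, cdiff k (fun x => A x i j)) -> cdiff k (fun x => \det (A x)).
Proof.
move=> HA; rewrite /determinant; apply: cdiff_sum => s _.
apply: cdiffM; first exact: cdiff_cst.
by apply: cdiff_prod => i _; exact: HA.
Qed.

Lemma cdiff_mulmx k m p q (A : T -> 'M[R]_(m, p)) (B : T -> 'M[R]_(p, q)) :
  (forall i j, cdiff k (fun x => A x i j)) ->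
  (forall i j, cdiff k (fun x => B x i j)) ->
  forall i j, cdiff k (fun x => (A x *m B x) i j).
Proof.
move=> HA HB i j; under eq_fun do rewrite mxE.
by apply: cdiff_sum => l _; apply: cdiffM.
Qed.

(** Cramer's formula: each entry is a cofactor divided by the determinant, both polynomial in the
    entries of [A]. *)
Lemma cdiff_invmx k m (A : T -> 'M[R]_m) :
  (forall x, K x -> A x \in unitmx) ->
  (forall i j, cdiff k (fun x => A x i j)) ->
  forall i j, cdiff k (fun x => invmx (A x) i j).
Proof.
move=> uA HA i j.
apply: (@cdiff_eq _ (fun x => (\det (A x))^-1 * cofactor (A x) j i)).
  by move=> x Kx; rewrite /invmx uA// !mxE.
apply: cdiffM.
  apply: cdiffV; last exact: cdiff_det.
  by move=> x Kx; have := uA x Kx; rewrite unitmxE unitfE.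
rewrite /cofactor; apply: cdiffM; first exact: cdiff_cst.
apply: cdiff_det => i' j'.
by under eq_fun do rewrite !mxE; exact: HA.
Qed.

Hypothesis KO : K `<=` closure O.

(** Every point of [K] adheres to [O], so the limit defining [pd] is along a proper filter and is
    unique; a continuous [g] that equals the derivative on [O] supplies it. This identifies [pd]
    with the otherwise unspecified derivatives in [cdiff]. *)
Lemma pd_within (V : normedModType R) i (f g : T -> V) :
  {within K, continuous g} -> (forall x, O x -> 'D_(e_ i) f x = g x) ->
  forall x, K x -> pd O i f x = g x.
Proof.
move=> cg dfg x Kx.
have PF : ProperFilter (within O (nbhs x)).
  by apply: within_nbhs_proper; exact: KO.
have cgO : g y @[y --> within O (nbhs x)] --> g x.
  apply: (@cvg_trans _ (g y @[y --> within K (nbhs x)])); last first.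
    by move/subspace_continuousP: cg; exact.
  by move=> A; rewrite /within/= !nbhs_simpl/=; apply: filterS => y + Oy; apply; exact: OK.
apply: cvg_lim; first exact: norm_hausdorff.
apply: cvg_trans; last exact: cgO.
apply: near_eq_cvg; rewrite near_withinE.
by apply: nearW => y Oy; rewrite dfg.
Qed.

Lemma within_row m (g : 'I_m -> T -> R) : (forall i, {within K, continuous (g i)}) ->
  {within K, continuous (fun x => \row_i g i x : 'rV[R]_m)}.
Proof.
move=> cg; apply/subspace_continuousP => x Kx.
apply/cvgrPdist_le => /= e e0.
near=> y.
rewrite /Num.Def.normr/= mx_normrE (bigmax_le _ (ltW e0))//= => i _.
rewrite !mxE/=.
move: i; near: y; apply: filter_forall => /= i.
have /subspace_continuousP/(_ x Kx)/cvgrPdist_le/(_ _ e0) := cg i.2.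
exact.
Unshelve. all: by end_near. Qed.

End UpTo.


(** * The velocity law *)

Section FBeta.
Context {R : realType}.
Variables (alpha beta : R).
Hypotheses (alpha_gt0 : 0 < alpha) (beta_ge0 : 0 <= beta).

Definition f_beta' (s : R) : R :=
  let q := Num.sqrt (alpha ^+ 2 + 4 * beta * s) in
  - 4 * beta * (q * (alpha + q) ^+ 2)^-1.

(** Strictness at [s = 0] comes from [alpha > 0]. It keeps the square root away from its
    singularity, so that [f_beta] and [f_beta'] are continuous also at the value [0] reached where
    the gradient vanishes. *)
Lemma discr_gt0 s : 0 <= s -> 0 < alpha ^+ 2 + 4 * beta * s.
Proof. by move=> s0; rewrite ltr_pwDl ?exprn_gt0// !mulr_ge0. Qed.

Lemma is_derive_f_beta (s : R) : 0 <= s -> is_derive s 1 (f_beta alpha beta) (f_beta' s).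
Proof.
move=> s0; have d0 := discr_gt0 s0.
have q0 : 0 < Num.sqrt (alpha ^+ 2 + 4 * beta * s) by rewrite sqrtr_gt0.
pose p t := alpha ^+ 2 + 4 * beta * t.
have dp : is_derive s 1 p (4 * beta).
  rewrite /p; apply: is_derive_eq => /=.
  by rewrite /GRing.scale/=; ring.
have dq : is_derive s 1 (Num.sqrt \o p) ((2 * Num.sqrt (p s))^-1 * (4 * beta)).
  by apply: is_derive1_comp; exact: is_derive1_sqrt.
have aq0 : alpha + Num.sqrt (p s) != 0 by rewrite gt_eqF// addr_gt0.
have daq : is_derive s 1 (fun t => alpha + Num.sqrt (p t)) ((2 * Num.sqrt (p s))^-1 * (4 * beta)).
  by rewrite -[X in is_derive _ _ _ X]add0r; apply: is_deriveD.
have [dd ddE] := daq.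
rewrite /f_beta; apply: DeriveDef.
  by apply: derivableM; [exact: derivable_cst|exact: derivableV].
rewrite deriveMl; last by apply: derivableV.
rewrite deriveV// ddE /f_beta' -/(p s) /GRing.scale/=.
move: q0 aq0; rewrite -/(p s); move: (Num.sqrt (p s)) => q q0 aq0.
by field; rewrite (gt_eqF q0) aq0.
Qed.

Lemma continuous_f_beta (s : R) : 0 <= s -> {for s, continuous (f_beta alpha beta)}.
Proof.
move=> s0; apply/differentiable_continuous/derivable1_diffP.
by have [] := is_derive_f_beta s0.
Qed.

Lemma continuous_f_beta' (s : R) : 0 <= s -> {for s, continuous f_beta'}.
Proof.
move=> s0; have d0 := discr_gt0 s0.
have q0 : 0 < Num.sqrt (alpha ^+ 2 + 4 * beta * s) by rewrite sqrtr_gt0.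
have cq : Num.sqrt (alpha ^+ 2 + 4 * beta * t) @[t --> s] -->
    Num.sqrt (alpha ^+ 2 + 4 * beta * s).
  apply: continuous_cvg; first exact: sqrt_continuous.
  by apply: cvgD; [exact: cvg_cst|apply: cvgM; [exact: cvg_cst|exact: cvg_id]].
rewrite /prop_for /continuous_at /f_beta'; apply: cvgM; first exact: cvg_cst.
apply: cvgV; first by rewrite mulf_neq0 ?expf_neq0// gt_eqF// addr_gt0.
apply: cvgM => //; rewrite expr2; under eq_fun do rewrite expr2.
by apply: cvgM; apply: cvgD => //; exact: cvg_cst.
Qed.

End FBeta.

Section Flux.
Context {R : realType} {n : nat}.
Notation T := 'rV[R]_n.+1.
Variables (O K : set T) (alpha beta : R).
Hypotheses (oO : open O) (OK : O `<=` K).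
Hypotheses (alpha_gt0 : 0 < alpha) (beta_ge0 : 0 <= beta).

(* The norm of [y] is not differentiable where [y] vanishes, but there the product
   has derivative [f_beta 0 * y' k], because [y k] vanishes too.  The remaining term
   [A * (y k / N)] of the derivative is continuous since [`|y k| <= N] and [A] tends
   to [0] at the zeros of [N]; the convention [x / 0 = 0] gives it the right value. *)
Lemma cdiff_f_beta_norm m (y : 'I_m -> T -> R) :
  (forall j, cdiff O K 1 (y j)) -> forall k,
  cdiff O K 1 (fun x => f_beta alpha beta (Num.sqrt (\sum_j y j x ^+ 2)) * y k x).
Proof.
move=> Hy k.
pose S x := \sum_j y j x ^+ 2.
have S0 x : 0 <= S x by apply: sumr_ge0 => j _; exact: sqr_ge0.
have HS : cdiff O K 1 S.
  by apply: cdiff_sum => j _; under eq_fun do rewrite expr2; exact: cdiffM.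
have y_le j x : `|y j x| <= Num.sqrt (S x).
  rewrite -sqrtr_sqr ler_sqrt ?S0// /S (bigD1 j)//= lerDl.
  by apply: sumr_ge0 => ? _; exact: sqr_ge0.
pose N x := Num.sqrt (S x).
have cN x : K x -> N y @[y --> within K (nbhs x)] --> N x.
  move=> Kx; apply: (@continuous_cvg _ _ _ _ _ S (@Num.sqrt R)); first exact: sqrt_continuous.
  by have /subspace_continuousP := cdiff_continuous HS; exact.
have cE x : K x -> f_beta alpha beta (N y) @[y --> within K (nbhs x)] --> f_beta alpha beta (N x).
  move=> Kx; apply: (@continuous_cvg _ _ _ _ _ N (f_beta alpha beta)); last exact: cN.
  by apply: continuous_f_beta => //; exact: sqrtr_ge0.
have cE' x : K x -> f_beta' alpha beta (N y) @[y --> within K (nbhs x)] --> f_beta' alpha beta (N x).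
  move=> Kx; apply: (@continuous_cvg _ _ _ _ _ N (f_beta' alpha beta)); last exact: cN.
  by apply: continuous_f_beta' => //; exact: sqrtr_ge0.
have cy j x : K x -> y j z @[z --> within K (nbhs x)] --> y j x.
  by have /subspace_continuousP := cdiff_continuous (Hy j); exact.
have /choice[y' Hy'] : forall j, exists y' : 'I_n.+1 -> T -> R, forall i,
    (forall x, O x -> is_derive x (delta_mx 0 i) (y j) (y' i x)) /\ cdiff O K 0 (y' i).
  by move=> j; have [_] := Hy j.
have cy' j i x : K x -> y' j i z @[z --> within K (nbhs x)] --> y' j i x.
  by have /subspace_continuousP := cdiff_continuous (Hy' j i).2; exact.
split; first by apply/subspace_continuousP => x Kx; apply: cvgM; [exact: cE|exact: cy].
(* Since [N ^ 2 = S], the derivative of [N] is [(sum_j y_j y'_j) / N]. Thus [A] is [N] times the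
   derivative of [f_beta] composed with [N], and the division by [N] is left to the bounded factor
   [y k / N]. *)
pose A i x := f_beta' alpha beta (N x) * \sum_j y j x * y' j i x.
have cA i x : K x -> A i z @[z --> within K (nbhs x)] --> A i x.
  move=> Kx; apply: cvgM; first exact: cE'.
  by apply: cvg_big => [|j _]; [exact: add_continuous|apply: cvgM; [exact: cy|exact: cy']].
exists (fun i x => f_beta alpha beta (N x) * y' k i x + A i x * (y k x / N x)) => i; split.
  move=> x Ox; have Kx := OK Ox.
  have [N0|N0] := eqVneq (N x) 0.
    have y0 j : y j x = 0.
      by apply/eqP; rewrite -normr_le0 (le_trans (y_le j x))// -/(N x) N0.
    rewrite y0 mul0r mulr0 addr0.
    have [dk dkE] := (Hy' k i).1 x Ox.
    suff H : h^-1 *: (f_beta alpha beta (N (h *: delta_mx 0 i + x)) * y k (h *: delta_mx 0 i + x)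
         - f_beta alpha beta (N x) * y k x) @[h --> 0^'] --> f_beta alpha beta (N x) * y' k i x.
      apply: DeriveDef; first by apply/cvg_ex; eexists; exact: H.
      exact/cvg_lim/H.
    (* Because [y k x = 0], the difference quotient factors: [f_beta] of the norm at the displaced
       point, where continuity is enough, times the difference quotient of [y k]. *)
    have -> : (fun h : R => h^-1 *: (f_beta alpha beta (N (h *: delta_mx 0 i + x)) * y k (h *: delta_mx 0 i + x)
         - f_beta alpha beta (N x) * y k x)) =
       (fun h : R => f_beta alpha beta (N (h *: delta_mx 0 i + x)) *
         (h^-1 *: (y k (h *: delta_mx 0 i + x) - y k x))).
      by apply/funext => h; rewrite y0 mulr0 !subr0 [LHS]mulrCA.
    apply: cvgM; last by rewrite -dkE; exact: dk.
    have cEx : {for x, continuous (fun x => f_beta alpha beta (N x))}.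
      move=> B /(cE x Kx); rewrite /within/= !nbhs_simpl/= => BK.
      have Onx : nbhs x O by exact: open_nbhs_nbhs.
      by apply: filterS2 BK Onx => z Bz /OK Kz; exact: Bz.
    apply: (@continuous_cvg _ _ _ _ _ (fun h : R => h *: delta_mx 0 i + x) (fun x => f_beta alpha beta (N x))); first exact: cEx.
    exact: cvg_line.
  have S_gt0 : 0 < S x by rewrite -sqrtr_gt0 lt0r N0 sqrtr_ge0.
  have dS : is_derive x (delta_mx 0 i) S (\sum_j (y j x * y' j i x + y j x * y' j i x)).
    rewrite (_ : S = \sum_j (fun x => y j x ^+ 2)); last first.
      by apply/funext => z; rewrite fct_sumE.
    apply: is_derive_sum => j.
    have [dj djE] := (Hy' j i).1 x Ox.
    by under eq_fun do rewrite expr2; apply: is_deriveM; apply: DeriveDef.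
  have dN : is_derive x (delta_mx 0 i) N ((2 * Num.sqrt (S x))^-1 * \sum_j (y j x * y' j i x + y j x * y' j i x)).
    exact: is_derive_comp (is_derive1_sqrt S_gt0) dS.
  have dE := is_derive_comp (is_derive_f_beta alpha_gt0 beta_ge0 (sqrtr_ge0 (S x))) dN.
  apply: is_derive_eq (is_deriveM dE ((Hy' k i).1 x Ox)) _.
  rewrite /A -/(N x) /GRing.scale/= big_split/= -/(N x).
  by field.
split=> //; apply/subspace_continuousP => x Kx.
apply: cvgD; first by apply: cvgM; [exact: cE|exact: cy'].
have [N0|N0] := eqVneq (N x) 0; last first.
  apply: cvgM; first exact: cA.
  by apply: cvgM; [exact: cy|apply: cvgV => //; exact: cN].
have y0 j : y j x = 0.
  by apply/eqP; rewrite -normr_le0 (le_trans (y_le j x))// -/(N x) N0.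
have A0 : A i x = 0.
  by rewrite /A big1 ?mulr0// => j _; rewrite y0 mul0r.
rewrite A0 mul0r; apply/cvgrPdist_le => e e0.
have /cvgrPdist_le/(_ _ e0) := cA i x Kx; rewrite A0.
apply: filterS => z; rewrite !sub0r !normrN => Ae.
apply: le_trans Ae; rewrite normrM ler_piMr//.
rewrite normrM normfV (ger0_norm (sqrtr_ge0 _)).
have [z0|z0] := eqVneq (N z) 0; first by rewrite -/(N z) z0 invr0 mulr0 ler01.
have Nz_gt0 : 0 < N z by rewrite lt0r z0 sqrtr_ge0.
by rewrite ler_pdivrMr// mul1r; exact: y_le.
Qed.

End Flux.


(** * Leibniz rule with moving end points *)

Lemma within_comp (X Y Z : topologicalType) (A : set X) (B : set Y)
    (g : X -> Y) (f : Y -> Z) :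
  {within A, continuous g} -> (forall x, A x -> B (g x)) ->
  {within B, continuous f} -> {within A, continuous (fun x => f (g x))}.
Proof.
move=> /subspace_continuousP cg AB /subspace_continuousP cf.
apply/subspace_continuousP => x Ax P Pf.
have := cf _ (AB _ Ax) _ Pf; rewrite !nbhs_simpl/= /within/= => BP.
have := cg _ Ax _ BP; rewrite !nbhs_simpl/= /within/=.
by apply: filterS => y + Ay; apply => //; exact: AB.
Qed.

Lemma cvg_pair_nbhs (T : Type) (U V : topologicalType) (F : set_system T)
    {FF : Filter F} (f : T -> U) (g : T -> V) (a : U) (b : V) :
  f x @[x --> F] --> a -> g x @[x --> F] --> b -> (f x, g x) @[x --> F] --> (a, b).
Proof. by move=> fa gb; apply: cvg_pair. Qed.

Section Leibniz.
Context {R : realType}.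
Notation mu := (@lebesgue_measure R).

(** Differentiability of [F] is asked strictly inside the interval only, which suits functions that
    are merely continuous up to the faces. *)
Lemma continuous_Rintegral_FTC2 (f F : R -> R) (a b : R) : a < b ->
  {within `[a, b], continuous f} -> {within `[a, b], continuous F} ->
  (forall x, a < x < b -> is_derive x 1 F (f x)) ->
  \int[mu]_(x in `[a, b]) f x = F b - F a.
Proof.
move=> ab cf cF dF; rewrite /Rintegral (@continuous_FTC2 _ f F)//.
- have /(continuous_within_itvP _ ab)[_ ? ?] := cF.
  by split=> // x /[!in_itv]/=/dF[].
- by move=> x /[!in_itv]/=/dF[_ <-]; rewrite derive1E.
Qed.

Lemma Rintegral_scaling (f : R -> R) (H : R) : 0 < H ->
  {within `[- H, H], continuous f} ->
  \int[mu]_(x in `[- H, H]) f x = \int[mu]_(t in `[-1, 1]) (f (H * t) * H).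
Proof.
move=> H0 cf.
have dF (t : R) : is_derive t (1:R) ( *%R H : R -> R) H.
  rewrite (_ : *%R H = H \*: (id : R -> R))//.
  by apply: is_derive_eq => /=; rewrite [LHS]mulr1.
have F'E : ( *%R H : R -> R)^`()%classic = cst H.
  by apply/funext => t; rewrite derive1E; have [_ ->] := dF t.
have := @integration_by_substitution_increasing R ( *%R H) f (-1) 1.
rewrite mulrN1 mulr1 F'E => sub.
rewrite /Rintegral sub//.
- by move=> x y _ _; rewrite ltr_pM2l.
- by move=> x _; exact: cst_continuous.
- exact: is_cvg_cst.
- exact: is_cvg_cst.
- have cH : continuous ( *%R H : R -> R) by exact: mulrl_continuous.
  split=> [x _||]; first by have [] := dF x.
  + by apply: cvg_at_right_filter; exact: cH.
  + by apply: cvg_at_left_filter; exact: cH.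
Qed.


Lemma within_integrable (f : R -> R) (a b : R) : {within `[a, b], continuous f} ->
  mu.-integrable `[a, b] (EFin \o f).
Proof.
by move=> cf; apply: continuous_compact_integrable => //; exact: segment_compact.
Qed.

(** The order of [a] and [b] is left open because an increment of the half-thickness may have either
    sign. The bound on [|c - a|] forces the intermediate point to converge to [a] when [b] does. *)
Lemma MVT_sym (f df : R -> R) (A : interval R) (a b : R) : a \in A -> b \in A ->
  (forall x, x \in A -> is_derive x 1 f (df x)) ->
  exists2 c, c \in A & `|c - a| <= `|b - a| /\ f b - f a = df c * (b - a).
Proof.
have mvt x y : x \in A -> y \in A -> x <= y ->
    (forall z, z \in A -> is_derive z 1 f (df z)) ->
    exists2 c, c \in `[x, y] & f y - f x = df c * (y - x).
  move=> xA yA xy dfA.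
  have sub z : z \in `[x, y] -> z \in A.
    by rewrite in_itv/=; exact: (interval_is_interval xA yA).
  apply: (MVT_segment xy) => [z zxy|]; first exact/dfA/sub/subset_itv_oo_cc.
  by apply: derivable_within_continuous => z /sub/dfA[].
move=> aA bA dfA; have [ab|/ltW ba] := leP a b.
  have [c] := mvt _ _ aA bA ab dfA.
  rewrite in_itv/= => /andP[ac cb] E; exists c; last first.
    by rewrite !ger0_norm ?subr_ge0// lerD2r.
  by apply: (interval_is_interval aA bA); rewrite ac.
have [c] := mvt _ _ bA aA ba dfA.
rewrite in_itv/= => /andP[bc ca] E; exists c; last first.
  split; last by rewrite -opprB E -mulrN opprB.
  by rewrite !ler0_norm ?subr_le0// !opprB lerD2l lerN2.
by apply: (interval_is_interval bA aA); rewrite bc.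
Qed.

Section Thickness.
Variables (phi phi1 phi2 : R -> R -> R) (H H' : R -> R) (e : R).
Hypothesis e0 : 0 < e.
Hypothesis H0 : forall s, `|s| < e -> 0 < H s.
Hypothesis dH : forall s : R, `|s| < e -> is_derive s 1 H (H' s).
Hypothesis cH' : forall s : R, `|s| < e -> {for s, continuous H'}.
Let K := [set z : R * R | `|z.1| < e /\ `|z.2| <= H z.1].
Hypothesis cphi : {within K, continuous (fun z => phi z.1 z.2)}.
Hypothesis cphi1 : {within K, continuous (fun z => phi1 z.1 z.2)}.
Hypothesis cphi2 : {within K, continuous (fun z => phi2 z.1 z.2)}.
Hypothesis dphi1 : forall s l : R, `|s| < e -> `|l| < H s ->
  is_derive s 1 (phi ^~ l) (phi1 s l).
Hypothesis dphi2 : forall s l : R, `|s| < e -> `|l| < H s ->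
  is_derive l 1 (phi s) (phi2 s l).

(** The straightened strip: [(s, t) |-> (s, H s * t)] sends [S] into [K], and sends [|t| < 1]
    strictly inside, where [phi] has partial derivatives. The last factor [H s] of [g] is the
    Jacobian of this substitution. *)
Let S := [set z : R * R | `|z.1| < e /\ `|z.2| <= 1].
Let g s t := phi s (H s * t) * H s.
Let g' s t := phi1 s (H s * t) * H s + phi2 s (H s * t) * (H' s * t) * H s +
  phi s (H s * t) * H' s.

Let cH (s : R) : `|s| < e -> {for s, continuous H}.
Proof.
by move=> se; apply/differentiable_continuous/derivable1_diffP; have [] := dH se.
Qed.

Let within_S1 (f : R -> R) : (forall s : R, `|s| < e -> {for s, continuous f}) ->
  {within S, continuous (fun z : R * R => f z.1)}.
Proof.
move=> cf; apply/subspace_continuousP => z [z1 _].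
apply: cvg_within_filter; apply: (@continuous_cvg _ _ _ _ _ fst f).
  exact: cf.
exact: cvg_fst.
Qed.

Let within_S2 : {within S, continuous (fun z : R * R => z.2)}.
Proof.
apply/subspace_continuousP => z _; apply: cvg_within_filter; exact: cvg_snd.
Qed.

Let cscale : {within S, continuous (fun z : R * R => (z.1, H z.1 * z.2))}.
Proof.
apply/subspace_continuousP => z Sz; apply: cvg_pair_nbhs.
  by apply: cvg_within_filter; exact: cvg_fst.
apply: cvgM; first by have /subspace_continuousP := within_S1 cH; exact.
by have /subspace_continuousP := within_S2; exact.
Qed.

Let scaleK s t : `|s| < e -> `|t| <= 1 -> `|H s * t| <= H s.
Proof. by move=> se t1; rewrite normrM gtr0_norm ?H0// ler_piMr// ltW// H0. Qed.

Let scale_lt s t : `|s| < e -> `|t| < 1 -> `|H s * t| < H s.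
Proof. by move=> se t1; rewrite normrM gtr0_norm ?H0// gtr_pMr// H0. Qed.

Let within_S (f : R -> R -> R) : {within K, continuous (fun z => f z.1 z.2)} ->
  {within S, continuous (fun z => f z.1 (H z.1 * z.2))}.
Proof.
by apply: (within_comp cscale) => z [z1 z2]; split=> //=; exact: scaleK.
Qed.

Let cg : {within S, continuous (fun z => g z.1 z.2)}.
Proof. by move=> z; apply: continuousM; [exact: within_S|exact: within_S1]. Qed.

Let cg' : {within S, continuous (fun z => g' z.1 z.2)}.
Proof.
apply/subspace_continuousP => z Sz.
have cw f : {within S, continuous f} -> f y @[y --> within S (nbhs z)] --> (f z : R).
  by move=> /subspace_continuousP; exact.
have [c0 c1 c2] := And3 (cw _ (within_S cphi)) (cw _ (within_S cphi1)) (cw _ (within_S cphi2)).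
have [cHz cH'z cz] := And3 (cw _ (within_S1 cH)) (cw _ (within_S1 cH')) (cw _ within_S2).
by apply: cvgD; [apply: cvgD; [|apply: cvgM => //; apply: cvgM => //]|]; apply: cvgM.
Qed.

Let slice (f : R -> R -> R) s : `|s| < e -> {within S, continuous (fun z => f z.1 z.2)} ->
  {within `[-1, 1], continuous (f s)}.
Proof.
move=> se; apply: (@within_comp _ _ _ _ _ (fun t => (s, t)) (fun z => f z.1 z.2)).
  apply: continuous_subspaceT => t; apply: cvg_pair_nbhs; [exact: cvg_cst|exact: cvg_id].
by move=> t /=; rewrite in_itv/= -ler_norml.
Qed.

Let sliceK (f : R -> R -> R) s : `|s| < e -> {within K, continuous (fun z => f z.1 z.2)} ->
  {within `[- H s, H s], continuous (f s)}.
Proof.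
move=> se; apply: (@within_comp _ _ _ _ _ (fun t => (s, t)) (fun z => f z.1 z.2)).
  apply: continuous_subspaceT => t; apply: cvg_pair_nbhs; [exact: cvg_cst|exact: cvg_id].
by move=> t /=; rewrite in_itv/= -ler_norml.
Qed.

Let near_e (s : R) : `|s| < e -> \forall s' \near s, `|s'| < e.
Proof.
move=> se; have : open [set s : R | `|s| < e].
  rewrite (_ : [set _ | _] = ball (0:R) e); first exact: ball_open.
  by apply/seteqP; split=> x; rewrite /ball/= sub0r normrN.
by move=> oe; apply: open_nbhs_nbhs; split.
Qed.

(* Chain rule along [s' |-> (s', H s' * t)]: the increment in the second
   variable is controlled by the mean value theorem and the continuity of [phi2]. *)
Let dphiH (s t : R) : `|s| < e -> `|t| < 1 ->
  is_derive s 1 (fun s => phi s (H s * t)) (phi1 s (H s * t) + phi2 s (H s * t) * (H' s * t)).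
Proof.
move=> se t1; set c := H s * t.
have [d1 d1E] := dphi1 se (scale_lt se t1).
have [dHs dHsE] := dH se.
have cvgs : (h *: 1 + s : R) @[h --> (0:R)^'] --> s by exact: (@cvg_line R R^o s 1).
have cvgH : H (h *: 1 + s : R) @[h --> (0:R)^'] --> H s.
  by apply: (@continuous_cvg _ _ _ _ _ (fun h : R => h *: 1 + s) H) cvgs; exact: cH.
pose d h := H (h *: 1 + s) * t.
have cvgd : d h @[h --> (0:R)^'] --> c by apply: cvgM => //; exact: cvg_cst.
have nse : \forall h \near (0:R)^', `|h *: 1 + s : R| < e.
  by have := cvgs _ (near_e se).
(* The inequality [|c| < H s] is strict, hence survives a small change of [s]: both [c] and [d h]
   lie in the open section of the strip at the displaced parameter, as the mean value theorem
   requires. *)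
have ncH : \forall h \near (0:R)^', `|c| < H (h *: 1 + s).
  by apply: (cvgr_gt _ cvgH); exact: scale_lt.
(* [xi h] is the mean value point between [c] and [d h]. Where the two conditions fail the value is
   a dummy [0]; they hold for all small [h]. *)
have /choice[xi Hxi] : forall h : R, exists xi : R,
    `|h *: 1 + s : R| < e -> `|c| < H (h *: 1 + s) ->
    [/\ `|xi| < H (h *: 1 + s), `|xi - c| <= `|d h - c| &
     phi (h *: 1 + s) (d h) - phi (h *: 1 + s) c = phi2 (h *: 1 + s) xi * (d h - c)].
  move=> h; have [he|] := boolP (`|h *: 1 + s : R| < e); last by exists 0.
  have [hH|] := boolP (`|c| < H (h *: 1 + s)); last by exists 0.
  have := @MVT_sym (phi (h *: 1 + s)) (phi2 (h *: 1 + s))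
    `](- H (h *: 1 + s)), (H (h *: 1 + s))[ c (d h).
  rewrite !in_itv/= -!ltr_norml => /(_ hH (scale_lt he t1)) [|xi].
    by move=> x; rewrite in_itv/= -ltr_norml; exact: dphi2.
  by rewrite in_itv/= -ltr_norml => xiH [xic E]; exists xi => _ _.
have cvgxi : xi h @[h --> (0:R)^'] --> c.
  apply/cvgrPdist_le => r r0.
  have /cvgrPdist_le/(_ r r0) cvgdr := cvgd.
  near=> h; rewrite distrC.
  have [||_ + _] := Hxi h; [by near: h|by near: h|].
  by move=> /le_trans; apply; rewrite distrC; near: h.
have cvg2 : phi2 (h *: 1 + s) (xi h) @[h --> (0:R)^'] --> phi2 s c.
  move=> P P2.
  have Ksc : K (s, c) by split=> //=; exact/ltW/scale_lt.
  have /subspace_continuousP/(_ _ Ksc _ P2) := cphi2.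
  rewrite !nbhs_simpl/= /within/= => nP.
  have : (h *: 1 + s, xi h) @[h --> (0:R)^'] --> (s, c) by exact: cvg_pair_nbhs.
  move=> /(_ _ nP); rewrite !nbhs_simpl/= => nP'.
  near=> h.
  have : K (h *: 1 + s, xi h) -> P (phi2 (h *: 1 + s) (xi h)) by near: h.
  apply; split=> /=; first by near: h.
  by have [||/ltW] := Hxi h; [by near: h|by near: h|].
suff Q : h^-1 *: (phi (h *: 1 + s) (d h) - phi s c) @[h --> 0^'] -->
    phi1 s c + phi2 s c * (H' s * t).
  by apply: DeriveDef; [apply/cvg_ex; eexists; exact: Q|exact/cvg_lim/Q].
have cvgq : h^-1 *: (phi (h *: 1 + s) c - phi s c) + phi2 (h *: 1 + s) (xi h) *
    (h^-1 *: (H (h *: 1 + s) - H s) * t) @[h --> 0^'] --> phi1 s c + phi2 s c * (H' s * t).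
  apply: cvgD; first by rewrite -d1E; exact: d1.
  apply: cvgM => //; apply: cvgM; last exact: cvg_cst.
  by rewrite -dHsE; exact: dHs.
apply: cvg_trans cvgq; apply: near_eq_cvg; near=> h.
have [||_ _ E] := Hxi h; [by near: h|by near: h|].
have -> : phi (h *: 1 + s) (d h) =
    phi2 (h *: 1 + s) (xi h) * (d h - c) + phi (h *: 1 + s) c by rewrite -E subrK.
by rewrite /GRing.scale/= /d /c; ring.
Unshelve. all: by end_near. Qed.

Let dg (s t : R) : `|s| < e -> `|t| < 1 -> is_derive s 1 (g ^~ t) (g' s t).
Proof.
move=> se t1; apply: is_derive_eq (is_deriveM (dphiH se t1) (dH se)) _.
by rewrite /g' /GRing.scale/=; ring.
Qed.

(** Halving [e] gives a compact rectangle inside [S], on which the continuous function [|g'|]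
    attains a maximum. The bound is the constant that dominates the derivative under the integral
    sign. *)
Let bounded_g' : exists M, forall s t, `|s| <= e / 2 -> `|t| <= 1 -> `|g' s t| <= M.
Proof.
pose B := [set` `[- (e / 2), e / 2]] `*` [set` `[-1, 1]] : set (R * R).
have e2 : e / 2 < e by rewrite ltr_pdivrMr// ltr_pMr// ltr1n.
have BS : B `<=` S.
  move=> [s t] [] /=; rewrite !in_itv/= -!ler_norml => se t1; split=> //=.
  exact: le_lt_trans e2.
have cB : compact B by apply: compact_setX; exact: segment_compact.
have cgB : {within B, continuous (fun z => `|g' z.1 z.2|)}.
  have cg'B := continuous_subspaceW BS cg'.
  apply/subspace_continuousP => z Bz; apply: cvg_norm.
  by have /subspace_continuousP := cg'B; exact.
have B0 : B !=set0.
  by exists (0, 0); split; rewrite /= in_itv/= oppr_le0 ?ler01// divr_ge0// ltW.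
have [z _ zmax] := compact_EVT_max B0 cB cgB.
exists `|g' z.1 z.2| => s t se t1; apply: (zmax (s, t)).
by rewrite inE; split; rewrite /= in_itv/= -ler_norml.
Qed.

Let thickness_g s : `|s| < e ->
  \int[mu]_(l in `[- H s, H s]) phi s l = \int[mu]_(t in `[-1, 1]) g s t.
Proof. by move=> se; rewrite (Rintegral_scaling (H0 se))//; exact: sliceK. Qed.

Let Rintegral_g' : \int[mu]_(t in `[-1, 1]) g' 0 t =
  \int[mu]_(l in `[- H 0, H 0]) phi1 0 l + H' 0 * (phi 0 (H 0) + phi 0 (- H 0)).
Proof.
have ze : `|0 : R| < e by rewrite normr0.
have c11 : (-1 : R) < 1 by exact: lt_trans (ltrN10 _) ltr01.
have cw (f : R -> R -> R) : {within K, continuous (fun z => f z.1 z.2)} ->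
    {within `[-1, 1], continuous (fun t => f 0 (H 0 * t))}.
  move=> cf; exact: (slice (f := fun s t => f s (H s * t)) ze (within_S cf)).
have cid : {within `[-1, 1], continuous (fun t : R => t)}.
  by apply: continuous_subspaceT => t; exact: cvg_id.
have ccst (c : R) : {within `[-1, 1], continuous (fun _ : R => c)}.
  by apply: continuous_subspaceT => t; exact: cvg_cst.
have cM (f1 f2 : R -> R) : {within `[-1, 1], continuous f1} -> {within `[-1, 1], continuous f2} ->
    {within `[-1, 1], continuous (fun t : R => f1 t * f2 t : R)}.
  by move=> c1 c2 t; apply: continuousM; [exact: c1|exact: c2].
have cD (f1 f2 : R -> R) : {within `[-1, 1], continuous f1} -> {within `[-1, 1], continuous f2} ->
    {within `[-1, 1], continuous (fun t : R => f1 t + f2 t : R)}.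
  by move=> c1 c2 t; apply: continuousD; [exact: c1|exact: c2].
pose w t := phi2 0 (H 0 * t) * H 0 * t + phi 0 (H 0 * t).
have cwt : {within `[-1, 1], continuous w}.
  by apply: cD; [apply: (cM) => //; apply: (cM) => //|]; exact: cw.
have -> : \int[mu]_(t in `[-1, 1]) g' 0 t =
    \int[mu]_(t in `[-1, 1]) (phi1 0 (H 0 * t) * H 0 + H' 0 * w t).
  by apply: eq_Rintegral => t _; rewrite /g' /w; ring.
rewrite RintegralD//; last 2 first.
- by apply: within_integrable; apply: cM => //; exact: cw.
- by apply: within_integrable; exact: cM.
rewrite -(Rintegral_scaling (H0 ze)); last exact: sliceK.
congr (_ + _); rewrite RintegralZl//; last exact: within_integrable.
congr (_ * _).
have dF (t : R) : -1 < t < 1 -> is_derive t 1 (fun t => phi 0 (H 0 * t) * t) (w t).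
  rewrite -ltr_norml => t1.
  have dlin : is_derive t 1 (fun t : R => H 0 * t) (H 0).
    by apply: is_derive_eq (is_deriveZ (H 0) (is_derive_id t (1:R))) _; rewrite [LHS]mulr1.
  have dphi : is_derive t 1 (fun t : R => phi 0 (H 0 * t)) (phi2 0 (H 0 * t) * H 0).
    by apply: (is_derive1_comp (dphi2 ze (scale_lt ze t1)) dlin).
  apply: is_derive_eq (is_deriveM dphi (is_derive_id t (1:R))) _.
  by rewrite /w /GRing.scale/=; ring.
(* The antiderivative [t * phi 0 (H 0 * t)] equals [- phi 0 (- H 0)] at [t = -1], whence the sum,
   not the difference, of the two face values. *)
rewrite (continuous_Rintegral_FTC2 c11 cwt _ dF).
  by rewrite mulr1 !mulrN1 opprK mulr1.
by apply: cM => //; exact: cw.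
Qed.

(* Substituting [l = H s * t] fixes the domain of integration, so that one can
   differentiate under the integral sign; the term of the derivative carrying [H']
   is the derivative in [t] of [t * phi 0 (H 0 * t)]. *)
Lemma is_derive_thickness : is_derive (0 : R) 1
  (fun s => \int[mu]_(l in `[- H s, H s]) phi s l)
  (\int[mu]_(l in `[- H 0, H 0]) phi1 0 l + H' 0 * (phi 0 (H 0) + phi 0 (- H 0))).
Proof.
have ze : `|0 : R| < e by rewrite normr0.
have e2 : e / 2 < e by rewrite ltr_pdivrMr// ltr_pMr// ltr1n.
pose I : set R := [set` `](- (e / 2)), (e / 2)[].
(* The open interval is used because [g] is known to be differentiable in [s] only for [|t| < 1];
   the two end points do not change the integrals. *)
pose B : set R := [set` `]-1, 1[].
have I0 : I 0 by rewrite /I/= in_itv/= oppr_lt0 divr_gt0.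
have [M HM] := bounded_g'.
have I_e s : I s -> `|s| < e /\ `|s| <= e / 2.
  by rewrite /I/= in_itv/= -ltr_norml => se; split; [exact: lt_trans e2|exact: ltW].
have ooB t : B t -> `|t| < 1 by rewrite /B/= in_itv/= -ltr_norml.
have mB : measurable (B : set (measurableTypeR R)) by exact: measurable_itv.
have intB (f : R -> R) : {within `[-1, 1], continuous f} -> mu.-integrable B (EFin \o f).
  move=> /within_integrable; apply: integrableS => //; exact: subset_itv_oo_cc.
have RintB (f : R -> R) : {within `[-1, 1], continuous f} ->
    \int[mu]_(t in B) f t = \int[mu]_(t in `[-1, 1]) f t.
  move=> cf; rewrite /B Rintegral_itv_bndo_bndc; last exact: intB.
  rewrite Rintegral_itv_obnd_cbnd//.
  apply: integrableS (within_integrable cf) => //; exact: subset_itv_oc_cc.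
have E1 s t : `|s| < e -> `|t| < 1 -> partial1of2 g s t = g' s t.
  by move=> se t1; rewrite partial1of2E; have [_ ->] := dg se t1.
have M0 : 0 <= M.
  by apply: le_trans (HM 0 0 _ _); rewrite ?normr0// divr_ge0// ltW.
have := @cvg_differentiation_under_integral R _ _ mu g B mB 0 (- (e / 2)) (e / 2) I0 _ _ (fun=> M) (fun=> M0).
move=> D.
have {D} : h^-1 *: ((\int[mu]_(t in B) g (h + 0) t) - \int[mu]_(t in B) g 0 t) @[h --> (0:R)^'] -->
    \int[mu]_(t in B) partial1of2 g 0 t.
  apply: D.
  - by move=> s /I_e[se _]; apply: intB; exact: slice se cg.
  - by move=> s t /I_e[se _] /ooB t1; have [] := dg se t1.
  - by apply: intB; apply: continuous_subspaceT => t; exact: cvg_cst.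
  - by move=> s t /I_e[se se2] /ooB t1; rewrite E1// HM// ltW.
have -> : \int[mu]_(t in B) partial1of2 g 0 t = \int[mu]_(t in B) g' 0 t.
  by apply: eq_Rintegral => t /set_mem /ooB t1; rewrite E1.
rewrite (RintB (g' 0)); last exact: (slice ze cg').
rewrite Rintegral_g' => D.
suff Q : h^-1 *: ((\int[mu]_(l in `[- H (h *: 1 + 0), H (h *: 1 + 0)]) phi (h *: 1 + 0) l) -
    \int[mu]_(l in `[- H 0, H 0]) phi 0 l) @[h --> (0:R)^'] -->
   (\int[mu]_(l in `[- H 0, H 0]) phi1 0 l + H' 0 * (phi 0 (H 0) + phi 0 (- H 0)) : R).
  by apply: DeriveDef; [apply/cvg_ex; eexists; exact: Q|exact/cvg_lim/Q].
apply: cvg_trans D; apply: near_eq_cvg; near=> h.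
have he : `|h| < e by near: h; exact: dnbhs0_lt.
have -> : h *: 1 + 0 = h + 0 :> R by rewrite [h *: 1]mulr1.
have he0 : `|h + 0| < e by rewrite addr0.
rewrite !RintB; [|exact: slice ze cg|exact: slice he0 cg].
by rewrite !thickness_g.
Unshelve. all: by end_near. Qed.

End Thickness.
End Leibniz.


(** * Coordinates and geometry of the fracture *)

Section Coordinates.
Context {R : realType}.

Definition widen3 (i : 'I_2) : 'I_3 := widen_ord (leqnSn 2) i.

Lemma widen3_neq2 i : (widen3 i == 2) = false.
Proof. by case: i => -[|[|]]. Qed.

Lemma ord3_ind (P : 'I_3 -> Prop) : P 0 -> P 1 -> P 2 -> forall k, P k.
Proof.
move=> P0 P1 P2 [[|[|[|//]]] lti].
- by rewrite (_ : Ordinal lti = 0)//; exact/val_inj.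
- by rewrite (_ : Ordinal lti = 1)//; exact/val_inj.
- by rewrite (_ : Ordinal lti = 2)//; exact/val_inj.
Qed.

Lemma big_ord3 (V : nmodType) (F : 'I_3 -> V) : \sum_k F k = F 0 + F 1 + F 2.
Proof.
rewrite !big_ord_recr big_ord0 /= add0r.
by congr (F _ + F _ + F _); exact/val_inj.
Qed.

Lemma big_ord2 (V : nmodType) (F : 'I_2 -> V) : \sum_k F k = F 0 + F 1.
Proof. by rewrite !big_ord_recr big_ord0 /= add0r; congr (F _ + F _); exact/val_inj. Qed.

Lemma row3E (x y z : R) : (row3 x y z 0 0 = x) * (row3 x y z 0 1 = y) * (row3 x y z 0 2 = z).
Proof. by rewrite !mxE. Qed.

Lemma point_ord2 (p : 'rV[R]_2) l : point p l 0 2 = l.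
Proof. by rewrite row3E. Qed.

Lemma base_point (p : 'rV[R]_2) l : base (point p l) = p.
Proof.
apply/rowP => -[[|[|//]] lti]; rewrite !mxE/=; congr (p 0 _); exact/val_inj.
Qed.

Lemma point_line (p : 'rV[R]_2) l (i : 'I_2) t :
  point (t *: delta_mx 0 i + p) l = t *: delta_mx 0 (widen3 i) + point p l.
Proof.
apply/rowP; apply: ord3_ind; rewrite !mxE ?eqxx/=.
- by congr (_ * _%:R + _); case: i => -[|[|//]].
- by congr (_ * _%:R + _); case: i => -[|[|//]].
- by rewrite (_ : 2 == _ = false) ?mulr0 ?add0r//; case: i => -[|[|//]].
Qed.

Lemma point_line2 (p : 'rV[R]_2) l t : point p (t + l) = t *: delta_mx 0 2 + point p l.
Proof.
by apply/rowP; apply: ord3_ind; rewrite !mxE/= ?mulr0 ?mulr1 ?add0r.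
Qed.

Lemma continuous_point (p : 'rV[R]_2) : continuous (point p).
Proof.
have -> : point p = (fun l => l *: delta_mx 0 2 + point p 0).
  by apply/funext => l; rewrite -[l in LHS]addr0 point_line2.
by move=> l; apply: cvgD; [apply: cvgZ; [exact: cvg_id|exact: cvg_cst]|exact: cvg_cst].
Qed.

Lemma base_line (v x : 'rV[R]_3) (t : R) : base (t *: v + x) = t *: base v + base x.
Proof. by apply/rowP => k; rewrite !mxE. Qed.

Lemma base_delta (i : 'I_2) : base (delta_mx 0 (widen3 i) : 'rV[R]_3) = delta_mx 0 i.
Proof. by apply/rowP => k; rewrite !mxE. Qed.

Lemma base_delta2 : base (delta_mx 0 2 : 'rV[R]_3) = 0.
Proof. by apply/rowP => -[[|[|//]] lti]; rewrite !mxE. Qed.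

Lemma continuous_rows (T : topologicalType) m (f : T -> 'rV[R]_m) :
  (forall i, continuous (fun x => f x 0 i)) -> continuous f.
Proof.
move=> cf x; apply/cvgrPdist_le => /= e e0.
near=> y.
rewrite /Num.Def.normr/= mx_normrE (bigmax_le _ (ltW e0))//= => i _.
rewrite !mxE/=.
move: i; near: y; apply: filter_forall => /= i.
have /cvgrPdist_le/(_ _ e0) := cf i.2 x.
by apply: filterS => y; rewrite (ord1 i.1).
Unshelve. all: by end_near. Qed.

Lemma continuous_base : continuous (@base R).
Proof.
apply: continuous_rows => i.
rewrite (_ : (fun x => _) = (fun x : 'rV[R]_3 => x 0 (widen_ord (leqnSn 2) i))).
  exact: coord_continuous.
by apply/funext => x; rewrite mxE.
Qed.

Lemma derivable_base (f : 'rV[R]_2 -> R) x v :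
  derivable f (base x) (base v) -> is_derive x v (fun x => f (base x)) ('D_(base v) f (base x)).
Proof.
rewrite /derivable /derive.
set g1 := fun h => h^-1 *: _; move=> dg1.
have E : (fun h : R => h^-1 *: (f (base (h *: v + x)) - f (base x))) = g1.
  by apply/funext => h; rewrite base_line.
by apply: DeriveDef; rewrite /derivable /derive E.
Qed.

Lemma is_derive_curve (V : normedModType R) (f : V -> R) (c : R -> V) s v d :
  (forall t, c (t *: 1 + s) = t *: v + c s) ->
  is_derive (c s) v f d -> is_derive s 1 (fun t => f (c t)) d.
Proof.
move=> cE [df <-].
have E : (fun h : R => h^-1 *: (f (c (h *: 1 + s)) - f (c s))) =
    (fun h : R => h^-1 *: (f (h *: v + c s) - f (c s))).
  by apply/funext => h; rewrite cE.
by apply: DeriveDef; rewrite /derivable /derive E.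
Qed.

(** If the cross product vanishes, so do all 2 x 2 minors, that is,
    [A 1 k * row 0 - A 0 k * row 1 = 0] for each [k]. Independence of the rows then makes every
    entry zero, which contradicts independence itself. *)
Lemma cross_neq0 (A : 'M[R]_(2, 3)) : row_free A -> cross (row 0 A) (row 1 A) != 0.
Proof.
move=> Afree; apply/eqP => A0.
have c0 (x y : R) : (forall k, x * A 0 k + y * A 1 k = 0) -> x = 0 /\ y = 0.
  move=> xy; pose c : 'rV[R]_2 := \row_i [:: x; y]`_i.
  have cA : c *m A = 0.
    apply/rowP => k; rewrite !mxE !big_ord_recr big_ord0/= add0r !mxE/=.
    by rewrite -[RHS](xy k); congr (_ * A _ _ + _ * A _ _); exact/val_inj.
  have /rowP c0 : c = 0 by apply: (row_free_inj Afree); rewrite cA mul0mx.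
  by have := c0 0; have := c0 1; rewrite !mxE.
have E k : A 1 k = 0 /\ - A 0 k = 0.
  apply: c0.
  have /rowP a0 := A0.
  have := a0 0; have := a0 1; have := a0 2; rewrite !row3E !mxE.
  move: k; apply: ord3_ind => + + + k; move: k; apply: ord3_ind; lra.
have [] := c0 1 0 _; last by move/eqP; rewrite oner_eq0.
by move=> k; have [_ /eqP] := E k; rewrite oppr_eq0 => /eqP ->; rewrite mulr0 mul0r addr0.
Qed.

Lemma dot_crossl (u v : 'rV[R]_3) : dot u (cross u v) = 0.
Proof. by rewrite /dot big_ord3 !row3E; ring. Qed.

Lemma dot_crossr (u v : 'rV[R]_3) : dot v (cross u v) = 0.
Proof. by rewrite /dot big_ord3 !row3E; ring. Qed.

Lemma dot_gt0 n (v : 'rV[R]_n) : v != 0 -> 0 < dot v v.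
Proof.
move=> v0; rewrite lt0r; apply/andP; split; last first.
  by apply: sumr_ge0 => k _; rewrite -expr2 sqr_ge0.
apply: contra v0; rewrite /dot psumr_eq0 => [|k _]; last by rewrite -expr2 sqr_ge0.
by move=> /allP v0; apply/eqP/rowP => k; have := v0 k (mem_index_enum _);
  rewrite /= mulf_eq0 orbb mxE => /eqP.
Qed.

End Coordinates.


(** * Passage between [Ck], [cdiff] and [pd] *)

Section CkTheory.
Context {R : realType} {n : nat}.
Notation T := 'rV[R]_n.+1.
Variable O : set T.

Lemma Ck_continuous (V : normedModType R) k (f : T -> V) : Ck O k f -> {within closure O, continuous f}.
Proof. by case: k => [|k] []. Qed.

Lemma Ck_cdiff (K : set T) k (f : T -> R) : K `<=` closure O -> Ck O k f -> cdiff O K k f.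
Proof.
move=> KO; elim: k f => [|k IH] f [cf Hf]; (split; first exact: continuous_subspaceW cf) => //.
exists (fun i => pd O i f) => i; have [dfi cfi] := Hf i.
by split; [move=> x /dfi[dx <-]; exact: DeriveDef|exact: IH].
Qed.

Lemma cdiff_pd (K : set T) (f : T -> R) : O `<=` K -> K `<=` closure O -> cdiff O K 1 f ->
  forall i, (forall x, O x -> is_derive x (delta_mx 0 i) f (pd O i f x)) /\
    {within K, continuous (pd O i f)}.
Proof.
move=> OK KO [_ [g dg]] i; have [dgi [cgi _]] := dg i.
have E x : K x -> pd O i f x = g i x.
  by apply: (pd_within OK KO) => // y /dgi[].
split; last by apply: within_eq cgi => x Kx; rewrite E.
by move=> x Ox; rewrite E; [exact: dgi|exact: OK].
Qed.

(** Uniqueness of continuous extensions: on [O] both [f] and [0] equal the derivative of a constant,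
    so by [pd_within] both agree on [K] with its [pd]. *)
Lemma within_eq0 (K : set T) (f : T -> R) : O `<=` K -> K `<=` closure O ->
  {within K, continuous f} -> (forall x, O x -> f x = 0) -> forall x, K x -> f x = 0.
Proof.
move=> OK KO cf f0 x Kx.
rewrite -(pd_within (i := 0) (f := cst 0) OK KO cf _ Kx); last first.
  by move=> y Oy; rewrite f0// derive_cst.
apply: (pd_within (g := cst 0) OK KO) Kx => [|y _]; last by rewrite derive_cst.
by apply: continuous_subspaceT => y; exact: cst_continuous.
Qed.

End CkTheory.

(** * The coordinate domain of the fracture and functions lifted from the rectangle *)

Section Fracture.
Context {R : realType}.
Variables (L a b : R) (h : 'rV[R]_2 -> R).
Let D := rectangle L a b.
Let Om := Omega_f D h.
Hypothesis h_smooth : smooth D h.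
Hypothesis h_gt0 : forall p, closure D p -> 0 < h p.

(* The part of the closure of [Omega_f] above the open rectangle: it contains the
   segments of integration and avoids the lateral faces. *)
Definition slab : set 'rV[R]_3 :=
  [set x | rectangle L a b (base x) /\ - h (base x) <= x 0 2 <= h (base x)].
Let K := slab.

Lemma open_rectangle : open D.
Proof.
rewrite (_ : D = ((fun p : 'rV[R]_2 => p 0 0) @^-1` `]0, L[) `&` ((fun p : 'rV[R]_2 => p 0 1) @^-1` `]a, b[)).
  by apply: openI; apply: open_comp; try (by move=> *; exact: coord_continuous); exact: interval_open.
by apply/seteqP; split => p /=; rewrite !in_itv.
Qed.

Lemma within_continuous_D (V : normedModType R) (f : 'rV[R]_2 -> V) :
  {within closure D, continuous f} -> forall p, D p -> {for p, continuous f}.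
Proof.
move=> cf p Dp.
have := continuous_subspaceW (@subset_closure _ D) cf.
by rewrite (continuous_open_subspace _ open_rectangle) => /(_ p (mem_set Dp)).
Qed.

Lemma continuous_h p : D p -> {for p, continuous h}.
Proof. exact/within_continuous_D/(Ck_continuous (h_smooth 0)). Qed.

Lemma is_derive_h i p : D p -> is_derive p (delta_mx 0 i) h (pd D i h p).
Proof. by move=> Dp; have [_ /(_ i)[/(_ p Dp)[? <-] _]] := h_smooth 1; exact: DeriveDef. Qed.

Lemma continuous_pdh i p : D p -> {for p, continuous (pd D i h)}.
Proof.
by apply: within_continuous_D; have [_ /(_ i)[_]] := h_smooth 1; exact: (@Ck_continuous _ _ _ _ 0).
Qed.

Lemma h_gt0D p : D p -> 0 < h p.
Proof. by move=> Dp; apply: h_gt0; exact: subset_closure. Qed.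

Lemma open_Omega : open Om.
Proof.
rewrite openE => x [Dx /andP[hx1 hx2]].
have nD : \forall y \near x, D (base y).
  apply: (continuous_base (x := x)); apply: open_nbhs_nbhs; split=> //.
  exact: open_rectangle.
have ch : h (base y) @[y --> x] --> h (base x).
  exact: (continuous_comp (continuous_base (x := x)) (continuous_h Dx)).
have c2 : (y 0 2 : R) @[y --> x] --> (x 0 2 : R) by exact: coord_continuous.
have n1 : \forall y \near x, 0 < h (base y) - y 0 2.
  by apply: (cvgr_gt _ (cvgB ch c2)); rewrite subr_gt0.
have n2 : \forall y \near x, 0 < h (base y) + y 0 2.
  by apply: (cvgr_gt _ (cvgD ch c2)); rewrite -ltrBlDl sub0r.
apply: filterS3 nD n1 n2 => y Dy; rewrite subr_gt0 -ltrBlDl sub0r => y1 y2.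
by split=> //; rewrite y1 y2.
Qed.

Lemma Omega_slab : Om `<=` K.
Proof. by move=> x [Dx /andP[/ltW x1 /ltW x2]]; split=> //; rewrite x1. Qed.

(** A point of the slab already lies above the open rectangle, so it is enough to shrink its height
    to [(1 - t) * lambda] with small [t > 0], leaving the base fixed. *)
Lemma slab_closure : K `<=` closure Om.
Proof.
move=> x [Dx /andP[x1 x2]] B Bx.
have h0 := h_gt0D Dx.
have nB := @cvg_line R _ x ((- x 0 2) *: (delta_mx 0 2 : 'rV[R]_3)) B Bx.
have /nbhs_ballP[e /= e0 eB] : nbhs (0 : R) (fun t => t != 0 -> B (t *: (- x 0 2 *: delta_mx 0 2) + x)).
  exact: nB.
pose t := Num.min (e / 2) (1 / 2).
have t0 : 0 < t by rewrite lt_min !divr_gt0.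
have te : t < e by rewrite gt_min ltr_pdivrMr// ltr_pMr// ltr1n.
have t1 : t < 1 by rewrite gt_min; apply/orP; right; lra.
exists (t *: (- x 0 2 *: delta_mx 0 2) + x); split; last first.
  by apply: eB; rewrite ?gt_eqF// /ball/= sub0r normrN gtr0_norm.
rewrite /Om /Omega_f/= scalerA base_line base_delta2 scaler0 add0r !mxE/= mulr1.
split=> //.
have -> : t * - x 0 2 + x 0 2 = (1 - t) * x 0 2 by ring.
have t2 : 0 < 1 - t by rewrite subr_gt0.
rewrite -ltr_norml normrM gtr0_norm//.
have : `|x 0 2| <= h (base x) by rewrite ler_norml x1.
move=> xh; apply: (@le_lt_trans _ _ ((1 - t) * h (base x))); first by rewrite ler_pM2l.
by rewrite gtr_pMl// gtrBl.
Qed.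

Lemma boundary_top p : D p -> boundary Om (point p (h p)).
Proof.
move=> Dp; have h0 := h_gt0D Dp; split.
  by apply: slab_closure; split; rewrite base_point// point_ord2 lexx andbT ge0_cp// ltW.
by move=> /interior_subset[_]; rewrite base_point point_ord2 ltxx andbF.
Qed.

Lemma boundary_bottom p : D p -> boundary Om (point p (- h p)).
Proof.
move=> Dp; have h0 := h_gt0D Dp; split.
  by apply: slab_closure; split; rewrite base_point// point_ord2 lexx ge0_cp// ltW.
by move=> /interior_subset[_]; rewrite base_point point_ord2 ltxx.
Qed.

Lemma cdiff_lift m k (f : 'rV[R]_2 -> 'rV[R]_m) l : Ck D k f ->
  cdiff Om K k (fun x => f (base x) 0 l).
Proof.
elim: k f => [|k IH] f Cf.
  split=> //; apply/subspace_continuousP => x [Dx _]; apply: cvg_within_filter.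
  have cf := within_continuous_D (Ck_continuous Cf) Dx.
  have cfb := continuous_comp (continuous_base (x := x)) cf.
  exact: (continuous_comp cfb (@coord_continuous _ _ _ 0 l _)).
split.
  apply/subspace_continuousP => x [Dx _]; apply: cvg_within_filter.
  have cf := within_continuous_D (Ck_continuous Cf) Dx.
  have cfb := continuous_comp (continuous_base (x := x)) cf.
  exact: (continuous_comp cfb (@coord_continuous _ _ _ 0 l _)).
have [_ {}Cf] := Cf.
(* The indices below 2 give the partial derivatives on the rectangle; for [i = 2] the default [0] of
   [oapp] is the right derivative, since the lifted function does not depend on lambda. *)
exists (fun i x => oapp (fun i => pd D i f (base x) 0 l) 0 (insub (i : nat) : option 'I_2)) => i.
case: insubP => /= [i' i2 i'E|i2]; last first.
  split; last exact: cdiff_cst.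
  have -> : i = 2 by apply/val_inj => /=; move: i2; case: i => -[|[|[]]].
  move=> x _; apply: is_derive_eq (derivable_base (f := fun p => f p 0 l) _) _ => /=.
    by rewrite base_delta2; exact: derivable0.
  by rewrite base_delta2 derive0.
have [dfi Cfi] := Cf i'.
have -> : i = widen3 i' by exact/val_inj.
split; last exact: IH.
move=> x [Dx _]; have [dfx dfxE] := dfi _ Dx.
apply: is_derive_eq (derivable_base (f := fun p => f p 0 l) _) _; rewrite base_delta.
  by move: dfx => /derivable_mxP; apply.
by rewrite -dfxE derive_mx// mxE.
Qed.

End Fracture.


Local Opaque pd.

(** * Regularity and invertibility of the metric, and its third row *)

Section Metric.
Context {R : realType}.
Variables (L a b : R) (h : 'rV[R]_2 -> R) (r : 'rV[R]_2 -> 'rV[R]_3).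
Let D := rectangle L a b.
Let Om := Omega_f D h.
Let K := slab L a b h.
Let X := fracture D r.
Hypothesis h_smooth : smooth D h.
Hypothesis h_gt0 : forall p, closure D p -> 0 < h p.
Hypothesis r_smooth : smooth D r.
Hypothesis r_immersed : immersed D r.
Hypothesis X_immersed : immersed Om X.

Let oOm : open Om := open_Omega h_smooth.
Let OmK : Om `<=` K := @Omega_slab _ L a b h.
Let Kcl : K `<=` closure Om := slab_closure h_gt0.

Let w p := cross (pd D 0 r p) (pd D 1 r p).

Let w_neq0 p : D p -> w p != 0.
Proof.
move=> Dp; have := cross_neq0 (r_immersed (subset_closure Dp)).
by rewrite /jacobian !rowK.
Qed.

Let cdiff_pdr k i l : cdiff Om K k (fun x => pd D i r (base x) 0 l).
Proof. by apply: cdiff_lift => //; have [_ /(_ i)[]] := r_smooth k.+1. Qed.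

Let cdiff_w k l : cdiff Om K k (fun x => w (base x) 0 l).
Proof.
move: l; rewrite /w; apply: ord3_ind; under eq_fun do rewrite row3E;
by apply: cdiffB; apply: cdiffM; exact: cdiff_pdr.
Qed.

Let nu p := unit_normal D r p.

Lemma cdiff_unit_normal k l : cdiff Om K k (fun x => unit_normal D r (base x) 0 l).
Proof.
under eq_fun do rewrite mxE; apply: cdiffM => //.
apply: cdiffV => //.
  by move=> x [Dx _]; rewrite gt_eqF// sqrtr_gt0 dot_gt0 ?w_neq0.
apply: cdiff_sqrt => //; first by move=> x [Dx _]; rewrite dot_gt0 ?w_neq0.
by apply: cdiff_sum => j _; apply: cdiffM; exact: cdiff_w.
Qed.

Lemma dot_unit_normal p : D p -> dot (unit_normal D r p) (unit_normal D r p) = 1.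
Proof.
move=> Dp; have w0 := dot_gt0 (w_neq0 Dp).
have -> : dot (unit_normal D r p) (unit_normal D r p) = (enorm (w p))^-1 ^+ 2 * dot (w p) (w p).
  by rewrite /dot mulr_sumr; apply: eq_bigr => k _; rewrite !mxE; ring.
by rewrite exprVn /enorm sqr_sqrtr ?ltW// mulVf// gt_eqF.
Qed.

Lemma dot_pd_unit_normal (i : 'I_2) p : dot (pd D i r p) (unit_normal D r p) = 0.
Proof.
have -> : dot (pd D i r p) (unit_normal D r p) = (enorm (w p))^-1 * dot (pd D i r p) (w p).
  by rewrite /dot mulr_sumr; apply: eq_bigr => k _; rewrite !mxE; ring.
have [->|->] : i = 0 \/ i = 1.
  by case: i => -[|[|//]] lti; [left|right]; exact/val_inj.
- by rewrite /w dot_crossl mulr0.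
- by rewrite /w dot_crossr mulr0.
Qed.

Lemma fractureE x l : X x 0 l = r (base x) 0 l + x 0 2 * nu (base x) 0 l.
Proof. by rewrite /X /fracture mxE; congr (_ + _); rewrite mxE. Qed.

Lemma cdiff_fracture k l : cdiff Om K k (fun x => X x 0 l).
Proof.
under eq_fun do rewrite fractureE.
apply: cdiffD; first exact: cdiff_lift.
apply: cdiffM; first exact: cdiff_coord.
exact: cdiff_unit_normal.
Qed.

(** On a face, [pd] of [X] is a limit of row vectors; the row of the componentwise derivatives is
    continuous on the slab and therefore equals that limit. *)
Lemma pd_fracture i l x : K x -> pd Om i X x 0 l = pd Om i (fun x => X x 0 l) x.
Proof.
move=> Kx.
have HX l' := cdiff_pd OmK Kcl (cdiff_fracture 1 l') i.
have -> : pd Om i X x = \row_l pd Om i (fun x => X x 0 l) x; last by rewrite mxE.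
apply: (pd_within (g := fun x => \row_l pd Om i (fun x => X x 0 l) x) OmK Kcl) => //.
  by apply: within_row => l'; have [] := HX l'.
move=> y Oy; have dX : derivable X y (delta_mx 0 i).
  by apply/derivable_mxP => i' j; rewrite (ord1 i'); have [/(_ y Oy)[]] := HX j.
rewrite derive_mx//; apply/rowP => j; rewrite !mxE.
by have [/(_ y Oy)[_ <-]] := HX j.
Qed.

Lemma cdiff_pd_fracture k i l : cdiff Om K k (fun x => pd Om i X x 0 l).
Proof.
have [_ [g dg]] := cdiff_fracture k.+1 l.
have [dgi cgi] := dg i.
apply: (cdiff_eq oOm OmK _ cgi) => x Kx.
rewrite pd_fracture//; apply/esym.
apply: (pd_within OmK Kcl) Kx; first exact: cdiff_continuous cgi.
by move=> y /dgi[].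
Qed.

Lemma pd_fracture_tangential (i : 'I_2) x l : Om x ->
  pd Om (widen3 i) X x 0 l =
  pd D i r (base x) 0 l + x 0 2 * 'D_(delta_mx 0 (widen3 i)) (fun x => nu (base x) 0 l) x.
Proof.
move=> Ox; have Kx := OmK Ox; rewrite (pd_fracture _ _ Kx).
have [/(_ x Ox)[_ <-] _] := cdiff_pd OmK Kcl (cdiff_fracture 1 l) (widen3 i).
have Dx := Ox.1.
have [_ /(_ i)[/(_ _ Dx)[dr drE] _]] := r_smooth 1.
have d1 : is_derive x (delta_mx 0 (widen3 i)) (fun x => r (base x) 0 l) (pd D i r (base x) 0 l).
  apply: is_derive_eq (derivable_base (f := fun p => r p 0 l) _) _; rewrite base_delta.
    by move: dr => /derivable_mxP; apply.
  by rewrite -drE derive_mx// mxE.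
have [dn _] := cdiff_pd OmK Kcl (cdiff_unit_normal 1 l) (widen3 i).
have [dnx _] := dn x Ox.
have d2 : is_derive x (delta_mx 0 (widen3 i)) (fun x : 'rV[R]_3 => x 0 2) 0.
  by apply: is_derive_eq (is_derive_coord _ _ x) _; rewrite widen3_neq2.
have d3 := is_deriveD d1 (is_deriveM d2 (derivableP dnx)).
have -> : (fun x => X x 0 l) = (fun x : 'rV[R]_3 => r (base x) 0 l) + (fun x : 'rV[R]_3 => x 0 2) * (fun x : 'rV[R]_3 => nu (base x) 0 l) :> ('rV[R]_3 -> R).
  by apply/funext => y; rewrite fractureE.
by have [_ ->] := d3; rewrite scaler0 addr0.
Qed.

Lemma pd_fracture_normal x l : Om x -> pd Om 2 X x 0 l = nu (base x) 0 l.
Proof.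
move=> Ox; have Kx := OmK Ox; rewrite (pd_fracture _ _ Kx).
have [/(_ x Ox)[_ <-] _] := cdiff_pd OmK Kcl (cdiff_fracture 1 l) 2.
have d1 (f : 'rV[R]_2 -> R) : is_derive x (delta_mx 0 2) (fun x => f (base x)) 0.
  apply: is_derive_eq (derivable_base (f := f) _) _; rewrite base_delta2 ?derive0//.
  exact: derivable0.
have d2 : is_derive x (delta_mx 0 2) (fun x : 'rV[R]_3 => x 0 2) 1.
  by apply: is_derive_eq (is_derive_coord _ _ x) _; rewrite eqxx.
have d3 := is_deriveD (d1 (fun p => r p 0 l)) (is_deriveM d2 (d1 (fun p => nu p 0 l))).
have -> : (fun x => X x 0 l) = (fun x : 'rV[R]_3 => r (base x) 0 l) + (fun x : 'rV[R]_3 => x 0 2) * (fun x : 'rV[R]_3 => nu (base x) 0 l) :> ('rV[R]_3 -> R).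
  by apply/funext => y; rewrite fractureE.
by have [_ ->] := d3; rewrite scaler0 !add0r [LHS]mulr1.
Qed.

Lemma metricE x : metric Om X x = jacobian Om X x *m (jacobian Om X x)^T.
Proof. by apply/matrixP => i j; rewrite !mxE; apply: eq_bigr => k _; rewrite !mxE. Qed.

Lemma cdiff_jacobian k i j : cdiff Om K k (fun x => jacobian Om X x i j).
Proof. by under eq_fun do rewrite mxE; exact: cdiff_pd_fracture. Qed.

Lemma cdiff_metric k i j : cdiff Om K k (fun x => metric Om X x i j).
Proof.
under eq_fun do rewrite metricE; apply: cdiff_mulmx => i' j'; last under eq_fun do rewrite mxE.
all: exact: cdiff_jacobian.
Qed.

Lemma jacobian_unit x : K x -> jacobian Om X x \in unitmx.
Proof. by move=> Kx; rewrite -row_free_unit; exact/X_immersed/Kcl. Qed.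

Lemma metric_unit x : K x -> metric Om X x \in unitmx.
Proof. by move=> Kx; rewrite metricE unitmx_mul unitmx_tr jacobian_unit. Qed.

Lemma det_metric_gt0 x : K x -> 0 < \det (metric Om X x).
Proof.
move=> Kx; rewrite metricE det_mulmx det_tr -expr2 exprn_even_gt0//=.
by have := jacobian_unit Kx; rewrite unitmxE unitfE.
Qed.

Lemma cdiff_sqrt_det k : cdiff Om K k (sqrt_det Om X).
Proof.
apply: cdiff_sqrt => //; first exact: det_metric_gt0.
by apply: cdiff_det => i j; exact: cdiff_metric.
Qed.

Lemma metric_sym x : (metric Om X x)^T = metric Om X x.
Proof. by rewrite metricE trmx_mul trmxK. Qed.

(* [n] is a unit vector orthogonal to [r_u], [r_v], hence also to [n_u], [n_v]; this
   gives the claim on [Om], and continuity extends it to the faces lambda = +-h. *)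
Lemma metric_row2 x : K x -> row 2 (metric Om X x) = delta_mx 0 2.
Proof.
move=> Kx.
suff H j : metric Om X x 2 j = (j == 2)%:R by apply/rowP => j; rewrite !mxE/= -H !mxE.
apply/eqP; rewrite -subr_eq0; apply/eqP; move: x Kx.
apply: (within_eq0 (f := fun x => metric Om X x 2 j - (j == 2)%:R) OmK Kcl).
  apply: (@cdiff_continuous _ _ Om K 0); apply: cdiffB; [exact: cdiff_metric|exact: cdiff_cst].
move=> x Ox; have Dx := Ox.1.
have G2 j' : metric Om X x 2 j' = \sum_k nu (base x) 0 k * pd Om j' X x 0 k.
  rewrite mxE /dot; apply: eq_bigr => k _; congr (_ * _); exact: pd_fracture_normal.
have [[i ->]|->] : (exists i, j = widen3 i) \/ j = 2.
  move: j {G2}; apply: ord3_ind; [left|left|by right].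
    by exists 0; exact/val_inj.
  by exists 1; exact/val_inj.
- rewrite widen3_neq2 subr0.
  rewrite G2; under eq_bigr do rewrite pd_fracture_tangential// mulrDr.
  rewrite big_split/=.
  have -> : \sum_k nu (base x) 0 k * pd D i r (base x) 0 k = 0.
    by rewrite -[RHS](dot_pd_unit_normal i (base x)); apply: eq_bigr => k _; rewrite mulrC.
  rewrite add0r.
  pose dn k := 'D_(delta_mx 0 (widen3 i)) (fun x => nu (base x) 0 k) x.
  have dnk k : is_derive x (delta_mx 0 (widen3 i)) (fun x => nu (base x) 0 k) (dn k).
    by have [/(_ x Ox)[? _] _] := cdiff_pd OmK Kcl (cdiff_unit_normal 1 k) (widen3 i); exact: DeriveDef.
  have d1 : is_derive x (delta_mx 0 (widen3 i)) (\sum_k (fun x => nu (base x) 0 k) * (fun x => nu (base x) 0 k))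
      (\sum_k (nu (base x) 0 k * dn k + nu (base x) 0 k * dn k)).
    by apply: is_derive_sum => k; exact: is_deriveM.
  have d0 : is_derive x (delta_mx 0 (widen3 i)) (\sum_k (fun x => nu (base x) 0 k) * (fun x => nu (base x) 0 k)) (0:R).
    apply: near_eq_is_derive (is_derive_cst (1:R) x _).
    have := open_nbhs_nbhs (conj oOm Ox).
    apply: filterS => y [Dy _]; rewrite fct_sumE.
    by rewrite -(dot_unit_normal Dy).
  have E0 : \sum_k nu (base x) 0 k * dn k = 0.
    have [_ E1] := d1; have [_] := d0; rewrite E1 big_split/= -mulr2n => /eqP.
    by rewrite mulrn_eq0 => /eqP.
  under eq_bigr do rewrite mulrCA.
  by rewrite -mulr_sumr E0 mulr0.
rewrite eqxx G2; under eq_bigr do rewrite pd_fracture_normal//.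
by rewrite [X in X - _](dot_unit_normal Dx) subrr.
Qed.

Lemma invmx_metric_sym x i j : K x ->
  invmx (metric Om X x) i j = invmx (metric Om X x) j i.
Proof. by move=> Kx; rewrite -[in LHS]metric_sym -trmx_inv mxE. Qed.

Lemma invmx_metric_row2 x j : K x -> invmx (metric Om X x) 2 j = (j == 2)%:R.
Proof.
move=> Kx.
have /rowP/(_ j) : row 2 (metric Om X x) *m invmx (metric Om X x) = row 2 1%:M.
  by rewrite -row_mul mulmxV// metric_unit.
by rewrite metric_row2// -rowE !mxE eq_sym.
Qed.

End Metric.


(** * Integration over the thickness *)

Section ThicknessDerivative.
Context {R : realType}.
Variables (L a b : R) (h : 'rV[R]_2 -> R).
Let D := rectangle L a b.
Let Om := Omega_f D h.
Let K := slab L a b h.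
Hypothesis h_smooth : smooth D h.
Hypothesis h_gt0 : forall p, closure D p -> 0 < h p.

Let OmK : Om `<=` K := @Omega_slab _ L a b h.
Let Kcl : K `<=` closure Om := slab_closure h_gt0.

Lemma slab_point p l : D p -> `|l| <= h p -> K (point p l).
Proof. by move=> Dp lh; split; rewrite base_point// point_ord2 -ler_norml. Qed.

Lemma Omega_point p l : D p -> `|l| < h p -> Om (point p l).
Proof. by move=> Dp lh; split; rewrite base_point// point_ord2 -ltr_norml. Qed.

(** The one-parameter rule is applied along the line [q s = p + s e_i], with
    [phi s l = F (point (q s) l)] and [H s = h (q s)]; [e] is a radius for which this line stays in
    the open rectangle. *)
Lemma is_derive_thickness_integral (F : 'rV[R]_3 -> R) (i : 'I_2) p :
  cdiff Om K 1 F -> D p ->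
  is_derive p (delta_mx 0 i) (thickness_integral h F)
    (thickness_integral h (pd Om (widen3 i) F) p +
     pd D i h p * (F (point p (h p)) + F (point p (- h p)))).
Proof.
move=> CF Dp; pose q (s : R) : 'rV[R]_2 := s *: delta_mx 0 i + p.
have q0 : q 0 = p by rewrite /q scale0r add0r.
have cq : continuous q.
  by move=> s; apply: cvgD; [apply: cvgZ; [exact: cvg_id|exact: cvg_cst]|exact: cvg_cst].
have qline (s t : R) : q (t *: 1 + s) = t *: delta_mx 0 i + q s.
  by rewrite /q [t *: 1]mulr1 scalerDl addrA.
have /nbhs_ballP[e /= e0 eD] : nbhs (0 : R) (q @^-1` D).
  by apply: cq; rewrite q0; apply: open_nbhs_nbhs; split=> //; exact: open_rectangle.
have De s : `|s| < e -> D (q s) by move=> se; apply: eD; rewrite /ball/= sub0r normrN.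
pose m (z : R * R) := point (q z.1) z.2.
have cm : continuous m.
  have -> : m = (fun z => z.1 *: delta_mx 0 (widen3 i) + (z.2 *: delta_mx 0 2 + point p 0)).
    by apply/funext => z; rewrite /m -[z.2 in LHS]addr0 point_line2 /q point_line addrCA.
  move=> z; have c1 : {for z, continuous (fst : R * R -> R)} by exact: cvg_fst.
  have c2 : {for z, continuous (snd : R * R -> R)} by exact: cvg_snd.
  have cc v : {for z, continuous (fun _ : R * R => v : 'rV[R]_3)} by exact: cst_continuous.
  exact: (continuousD (continuousZ c1 (cc _)) (continuousD (continuousZ c2 (cc _)) (cc _))).
pose K2 := [set z : R * R | `|z.1| < e /\ `|z.2| <= h (q z.1)].
have cmK (f : 'rV[R]_3 -> R) : {within K, continuous f} ->
    {within K2, continuous (fun z => f (point (q z.1) z.2))}.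
  apply: (@within_comp _ _ _ _ _ m f); first exact: continuous_subspaceT.
  by move=> z [z1 z2]; apply: slab_point => //; exact: De.
have pdF j := cdiff_pd OmK Kcl CF j.
have := @is_derive_thickness R (fun s l => F (point (q s) l))
  (fun s l => pd Om (widen3 i) F (point (q s) l)) (fun s l => pd Om 2 F (point (q s) l))
  (fun s => h (q s)) (fun s => pd D i h (q s)) e e0.
move=> T; have {T} : is_derive (0 : R) 1 (fun s => thickness_integral h F (q s))
    (thickness_integral h (pd Om (widen3 i) F) (q 0) +
     pd D i h (q 0) * (F (point (q 0) (h (q 0))) + F (point (q 0) (- h (q 0))))).
  apply: T.
  - by move=> s /De; exact: h_gt0D.
  - by move=> s /De Ds; apply: is_derive_curve (qline s) (is_derive_h h_smooth i Ds).
  - move=> s /De Ds; apply: (continuous_comp (cq s)).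
    exact: continuous_pdh.
  - exact: cmK (cdiff_continuous CF).
  - by apply: cmK; exact: (pdF _).2.
  - by apply: cmK; exact: (pdF _).2.
  - move=> s l /De Ds ls; apply: (is_derive_curve (v := delta_mx 0 (widen3 i)) (c := fun s => point (q s) l)).
      by move=> t; rewrite qline point_line.
    by apply: (pdF _).1; exact: Omega_point.
  - move=> s l /De Ds ls; apply: (is_derive_curve (v := delta_mx 0 2) (c := point (q s))).
      by move=> t; rewrite [t *: 1]mulr1 point_line2.
    by apply: (pdF _).1; exact: Omega_point.
rewrite q0 => -[dT TE].
have E : (fun t : R => t^-1 *: (thickness_integral h F (q (t *: 1 + 0)) - thickness_integral h F (q 0))) =
    (fun t : R => t^-1 *: (thickness_integral h F (t *: delta_mx 0 i + p) - thickness_integral h F p)).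
  by apply/funext => t; rewrite qline q0.
by apply: DeriveDef; [move: dT|move: TE]; rewrite /derivable /derive E.
Qed.

Lemma thickness_integral_pd2 (F : 'rV[R]_3 -> R) p : cdiff Om K 1 F -> D p ->
  thickness_integral h (pd Om 2 F) p = F (point p (h p)) - F (point p (- h p)).
Proof.
move=> CF Dp.
have [dF cF] := cdiff_pd OmK Kcl CF 2.
have hp := h_gt0D h_gt0 Dp.
have cpK (f : 'rV[R]_3 -> R) : {within K, continuous f} ->
    {within `[- h p, h p], continuous (fun l => f (point p l))}.
  apply: (@within_comp _ _ _ _ _ (point p) f); first exact/continuous_subspaceT/continuous_point.
  by move=> l /=; rewrite in_itv/= -ler_norml => lh; exact: slab_point.
have hh : - h p < h p by rewrite -subr_gt0 opprK addr_gt0.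
apply: (@continuous_Rintegral_FTC2 R _ (fun l => F (point p l)) _ _ hh).
- exact: cpK.
- exact: cpK (cdiff_continuous CF).
move=> l; rewrite -ltr_norml => lh.
apply: (is_derive_curve (v := delta_mx 0 2) (c := point p)).
  by move=> t; rewrite [t *: 1]mulr1 point_line2.
by apply: dF; exact: Omega_point.
Qed.

Lemma integrable_slice (F : 'rV[R]_3 -> R) p : {within K, continuous F} -> D p ->
  (@lebesgue_measure R).-integrable `[- h p, h p] (EFin \o (fun l => F (point p l))).
Proof.
move=> cF Dp; apply: within_integrable.
apply: (@within_comp _ _ _ _ _ (point p) F) => //; first exact/continuous_subspaceT/continuous_point.
by move=> l /=; rewrite in_itv/= -ler_norml => lh; exact: slab_point.
Qed.

Lemma thickness_integralD (F G : 'rV[R]_3 -> R) p :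
  {within K, continuous F} -> {within K, continuous G} -> D p ->
  thickness_integral h (fun x => F x + G x) p =
  thickness_integral h F p + thickness_integral h G p.
Proof. by move=> cF cG Dp; rewrite /thickness_integral RintegralD//; exact: integrable_slice. Qed.

End ThicknessDerivative.


(** * Regularity of the fluxes, flux through the faces and the integrated divergence *)

Section Reduction.
Context {R : realType}.
Variables (L a b alpha beta : R) (r : 'rV[R]_2 -> 'rV[R]_3).
Variables (h : 'rV[R]_2 -> R) (W : 'rV[R]_3 -> R).
Let D := rectangle L a b.
Let Om := Omega_f D h.
Let K := slab L a b h.
Let X := fracture D r.
Hypotheses (alpha_gt0 : 0 < alpha) (beta_ge0 : 0 <= beta).
Hypothesis h_smooth : smooth D h.
Hypothesis h_gt0 : forall p, closure D p -> 0 < h p.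
Hypothesis r_smooth : smooth D r.
Hypothesis r_immersed : immersed D r.
Hypothesis X_immersed : immersed Om X.
Hypothesis W_C3 : forall i, Ck Om 2 (pd Om i W).

Let oOm : open Om := open_Omega h_smooth.
Let OmK : Om `<=` K := @Omega_slab _ L a b h.
Let Kcl : K `<=` closure Om := slab_closure h_gt0.

Let cJ i j : cdiff Om K 1 (fun x => jacobian Om X x i j) :=
  cdiff_jacobian h_smooth h_gt0 r_smooth r_immersed 1 i j.

Let uJ x : K x -> jacobian Om X x \in unitmx := jacobian_unit h_gt0 X_immersed (x := x).

(* With G = J J^T, the vector y = J^-1 (grad W) has Euclidean norm |nabla_G W|_G. *)
Let y k x := \sum_i invmx (jacobian Om X x) k i * pd Om i W x.

Let cW i : cdiff Om K 1 (pd Om i W).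
Proof. by apply: cdiffW; apply: Ck_cdiff. Qed.

Let cy k : cdiff Om K 1 (y k).
Proof.
apply: cdiff_sum => i _; apply: cdiffM => //.
exact: (cdiff_invmx oOm OmK uJ cJ).
Qed.

Let pdW_y j x : K x -> pd Om j W x = \sum_k jacobian Om X x j k * y k x.
Proof.
move=> Kx; pose w : 'cV[R]_3 := \col_i pd Om i W x.
have : w = jacobian Om X x *m (invmx (jacobian Om X x) *m w) by rewrite mulKVmx// uJ.
move=> /colP/(_ j); rewrite mxE => ->.
rewrite mxE; apply: eq_bigr => k _; congr (_ * _).
by rewrite mxE; apply: eq_bigr => i _; congr (_ * _); rewrite mxE.
Qed.

Let invmx_metricE x i j : K x -> invmx (metric Om X x) i j =
  \sum_k invmx (jacobian Om X x) k i * invmx (jacobian Om X x) k j.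
Proof.
move=> Kx; have uJx := uJ Kx.
pose J := jacobian Om X x.
have -> : invmx (metric Om X x) = (invmx J)^T *m invmx J.
  apply: (can_inj (mulKmx (metric_unit h_gt0 X_immersed Kx))).
  rewrite mulmxV ?(metric_unit h_gt0 X_immersed)// metricE.
  by rewrite -mulmxA [_^T *m (_ *m _)]mulmxA -trmx_mul mulVmx// trmx1 mul1mx mulmxV.
by rewrite mxE; apply: eq_bigr => k _; rewrite mxE.
Qed.

Let normG_gradE x : K x -> normG_grad Om X W x = Num.sqrt (\sum_k y k x ^+ 2).
Proof.
move=> Kx; congr Num.sqrt.
under eq_bigr do under eq_bigr do rewrite invmx_metricE// -mulrA mulr_suml.
under eq_bigr do rewrite exchange_big/=.
rewrite exchange_big/=; apply: eq_bigr => k _.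
rewrite expr2 /y big_distrlr/=; apply: eq_bigr => i _; apply: eq_bigr => j _.
by rewrite mulrACA mulrA.
Qed.

(** From [grad W = J y], the product is [sum_k J_jk (f_beta(|y|) y_k)] with [|y|] Euclidean, a
    combination of the functions already shown to be C^1 at the zeros of [y] too. *)
Let cdiff_f_grad j : cdiff Om K 1 (fun x => f_beta alpha beta (normG_grad Om X W x) * pd Om j W x).
Proof.
apply: (cdiff_eq oOm OmK (f := fun x => \sum_k jacobian Om X x j k *
    (f_beta alpha beta (Num.sqrt (\sum_k y k x ^+ 2)) * y k x))).
  move=> x Kx; rewrite normG_gradE// (pdW_y _ Kx) mulr_sumr.
  by apply: eq_bigr => k _; rewrite mulrCA.
apply: cdiff_sum => k _; apply: cdiffM; first exact: cJ.
exact: (cdiff_f_beta_norm oOm OmK alpha_gt0 beta_ge0 cy).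
Qed.

Let flux := tangential_flux Om X alpha beta W.

Let csqrt_det : cdiff Om K 1 (sqrt_det Om X) :=
  cdiff_sqrt_det h_smooth h_gt0 r_smooth r_immersed X_immersed 1.

Lemma cdiff_tangential_flux i j : cdiff Om K 1 (flux i j).
Proof.
(* The factor [f_beta] alone need not be C^1 where [grad W] vanishes, so it is regrouped with the
   derivative of [W]. *)
have -> : flux i j = fun x => sqrt_det Om X x * invmx (metric Om X x) (widen3 i) (widen3 j) *
   (f_beta alpha beta (normG_grad Om X W x) * pd Om (widen3 j) W x).
  by apply/funext => x; rewrite /flux /tangential_flux -/(widen3 i) -/(widen3 j); ring.
apply: cdiffM => //; apply: cdiffM => //.
apply: (cdiff_invmx oOm OmK (metric_unit h_gt0 X_immersed)) => i' j'.
exact: cdiff_metric.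
Qed.

Let trans := transversal_flux Om X alpha beta W.

Lemma cdiff_transversal_flux : cdiff Om K 1 trans.
Proof.
have -> : trans = fun x => sqrt_det Om X x *
   (f_beta alpha beta (normG_grad Om X W x) * pd Om 2 W x).
  by apply/funext => x; rewrite /trans /transversal_flux; ring.
exact: cdiffM.
Qed.

Lemma area_factor_gt0 p : 0 < area_factor D h p.
Proof. by rewrite sqrtr_gt0 -addrA ltr_pwDl// addr_ge0// sqr_ge0. Qed.

(** Multiplying by [area_factor] undoes the normalisation of the face normal and leaves the vector
    [(- h_u, - h_v, s)]. The parameter [s] covers both faces, with [s = 1] on top and [s = -1] at
    the bottom. *)
Lemma face_flux s x : K x ->
  - dot (velocity Om X alpha beta W x) (face_normal D h s (base x)) *
    area_factor D h (base x) * sqrt_det Om X x =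
  s * trans x - \sum_(i < 2) \sum_(j < 2) pd D i h (base x) * flux i j x.
Proof.
move=> Kx.
have A0 := area_factor_gt0 (base x).
have G2 i : invmx (metric Om X x) i 2 = (i == 2)%:R.
  rewrite (invmx_metric_sym r i 2 Kx).
  exact: (invmx_metric_row2 h_smooth h_gt0 r_smooth r_immersed X_immersed).
have sym i j := invmx_metric_sym r i j Kx.
have g k : gradG Om X W x 0 k = invmx (metric Om X x) k 0 * pd Om 0 W x +
    invmx (metric Om X x) k 1 * pd Om 1 W x + (k == 2)%:R * pd Om 2 W x.
  by rewrite mxE big_ord3 -!/(metric _ _ _) !(sym _ k) G2.
have v k : velocity Om X alpha beta W x 0 k =
    - (f_beta alpha beta (normG_grad Om X W x) * gradG Om X W x 0 k).
  by rewrite /velocity mxE; congr (- _); rewrite mxE.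
have n k : face_normal D h s (base x) 0 k =
   (area_factor D h (base x))^-1 * row3 (- pd D 0 h (base x)) (- pd D 1 h (base x)) s 0 k.
  by rewrite /face_normal mxE.
have fluxE i j : flux i j x = f_beta alpha beta (normG_grad Om X W x) * sqrt_det Om X x
    * invmx (metric Om X x) (widen3 i) (widen3 j) * pd Om (widen3 j) W x by [].
rewrite /dot big_ord3 !v !n !row3E !g !big_ord2 !fluxE.
rewrite (_ : widen3 0 = 0); last exact/val_inj.
rewrite (_ : widen3 1 = 1); last exact/val_inj.
rewrite /trans /transversal_flux !(sym 2) !G2 /=.
move: (area_factor D h (base x)) A0 => A /lt0r_neq0 A0.
move: (f_beta _ _ _) (sqrt_det Om X x) => f q.
move: (pd D 0 h _) (pd D 1 h _) (pd Om 0 W x) (pd Om 1 W x) (pd Om 2 W x) => h0 h1 w0 w1 w2.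
move: (invmx _ 0 0) (invmx _ 0 1) (invmx _ 1 0) (invmx _ 1 1) => g00 g01 g10 g11.
by field.
Qed.

Lemma thickness_integral_sum (I : Type) (s : seq I) (F : I -> 'rV[R]_3 -> R) p :
  (forall i, {within K, continuous (F i)}) -> D p ->
  thickness_integral h (fun x => \sum_(i <- s) F i x) p =
  \sum_(i <- s) thickness_integral h (F i) p.
Proof.
move=> cF Dp; elim: s => [|i s IH].
  rewrite big_nil /thickness_integral.
  under eq_Rintegral do rewrite big_nil.
  by rewrite Rintegral_cst// mul0r.
rewrite big_cons -IH -(thickness_integralD (cF i) _ Dp).
  by congr (thickness_integral h _ p); apply/funext => x; rewrite big_cons.
apply: (@cdiff_continuous _ _ Om K 0); apply: cdiff_sum => j _.
by split.
Qed.

Lemma thickness_integral_flux_divergence p : D p ->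
  thickness_integral h (flux_divergence Om X alpha beta W) p =
  \sum_(i < 2) \sum_(j < 2) thickness_integral h (pd Om (widen3 i) (flux i j)) p +
  (trans (point p (h p)) - trans (point p (- h p))).
Proof.
move=> Dp.
have cpd i j : {within K, continuous (pd Om (widen3 i) (flux i j))}.
  exact: (cdiff_pd OmK Kcl (cdiff_tangential_flux i j) _).2.
have csum i : {within K, continuous (fun x => \sum_(j < 2) pd Om (widen3 i) (flux i j) x)}.
  by apply: (@cdiff_continuous _ _ Om K 0); apply: cdiff_sum => j _; split.
rewrite -(thickness_integral_pd2 h_gt0 cdiff_transversal_flux Dp).
under eq_bigr do rewrite -(thickness_integral_sum _ (cpd _) Dp).
rewrite -(thickness_integral_sum _ csum Dp) -(thickness_integralD _ _ Dp)//.
- by apply: (@cdiff_continuous _ _ Om K 0); apply: cdiff_sum => j _; split.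
- exact: (cdiff_pd OmK Kcl cdiff_transversal_flux _).2.
Qed.

End Reduction.

(** Derivability is part of the conclusion because ['D_] denotes a limit that receives a value even
    when it does not exist; the equation alone would not assert that the derivatives make sense. *)
Theorem proposition2 (R : realType) (L a b alpha beta Q volOmega : R)
  (r : 'rV[R]_2 -> 'rV[R]_3) (h qp qm : 'rV[R]_2 -> R) (W : 'rV[R]_3 -> R) :
  let D := rectangle L a b in
  let Om := Omega_f D h in
  let X := fracture D r in
  let v := velocity Om X alpha beta W in
  let flux := tangential_flux Om X alpha beta W in
  let qtp := fun p => qp p * area_factor D h p * sqrt_det Om X (point p (h p)) in
  let qtm := fun p => qm p * area_factor D h p * sqrt_det Om X (point p (- h p)) in
  0 < L -> a < b -> 0 < alpha -> 0 <= beta -> 0 < volOmega ->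
  smooth D r -> immersed D r ->
  smooth D h -> (forall p, closure D p -> 0 < h p) ->
  immersed Om X ->
  Ck Om 2 W -> (forall i, Ck Om 2 (pd Om i W)) ->
  (forall x, boundary Om x -> x 0 0 = 0 -> W x = 0) ->
  (forall x, boundary Om x -> x 0 2 = h (base x) ->
    dot (v x) (face_normal D h 1 (base x)) = - qp (base x)) ->
  (forall x, boundary Om x -> x 0 2 = - h (base x) ->
    dot (v x) (face_normal D h (-1) (base x)) = - qm (base x)) ->
  (forall x, boundary Om x -> x 0 0 = L -> dot (v x) (row3 1 0 0) = 0) ->
  (forall x, boundary Om x -> x 0 1 = b -> dot (v x) (row3 0 1 0) = 0) ->
  (forall x, boundary Om x -> x 0 1 = a -> dot (v x) (row3 0 (-1) 0) = 0) ->
  (forall p, D p ->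
    - (Q / volOmega) * thickness_integral h (sqrt_det Om X) p =
    thickness_integral h (flux_divergence Om X alpha beta W) p) ->
  forall p, D p ->
    (forall i j,
      derivable (thickness_integral h (flux i j)) p (delta_mx 0 i)) /\
    - (\sum_(i < 2) \sum_(j < 2)
        'D_(delta_mx 0 i) (thickness_integral h (flux i j)) p) =
    Q / volOmega * thickness_integral h (sqrt_det Om X) p + qtp p + qtm p.
Proof.
move=> D Om X v flux qtp qtm _ _ alpha_gt0 beta_ge0 _ r_smooth r_imm h_smooth h_gt0 X_imm
  _ W_C3 _ top bottom _ _ _ balance p Dp.
have Cflux i j := cdiff_tangential_flux alpha_gt0 beta_ge0 h_smooth h_gt0 r_smooth r_imm X_imm W_C3 i j.
have dflux i j := is_derive_thickness_integral h_smooth h_gt0 i (Cflux i j) Dp.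
split=> [i j|]; first by have [] := dflux i j.
pose trans := transversal_flux Om X alpha beta W.
(* [F l] collects the end-point terms [h_i * flux] at height [l]. It occurs both in the Leibniz
   derivatives and, with [face_flux], in the boundary data, and the two occurrences cancel. *)
pose F l := \sum_(i < 2) \sum_(j < 2) pd D i h p * flux i j (point p l).
have hp := h_gt0D h_gt0 Dp.
have Etop : qtp p = trans (point p (h p)) - F (h p).
  have Kp : slab L a b h (point p (h p)) by apply: slab_point => //; rewrite gtr0_norm.
  have := face_flux alpha beta W h_smooth h_gt0 r_smooth r_imm X_imm 1 Kp.
  rewrite (top _ (boundary_top h_gt0 Dp)); last by rewrite base_point point_ord2.
  rewrite base_point.
  by rewrite opprK mul1r.
have Ebottom : qtm p = - trans (point p (- h p)) - F (- h p).
  have Kp : slab L a b h (point p (- h p)) by apply: slab_point => //; rewrite normrN gtr0_norm.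
  have := face_flux alpha beta W h_smooth h_gt0 r_smooth r_imm X_imm (-1) Kp.
  rewrite (bottom _ (boundary_bottom h_gt0 Dp)); last by rewrite base_point point_ord2.
  rewrite base_point.
  by rewrite opprK mulN1r.
have dsum : \sum_(i < 2) \sum_(j < 2) 'D_(delta_mx 0 i) (thickness_integral h (flux i j)) p =
    \sum_(i < 2) \sum_(j < 2) thickness_integral h (pd Om (widen3 i) (flux i j)) p +
    (F (h p) + F (- h p)).
  rewrite /F -!big_split/=; apply: eq_bigr => i _.
  rewrite -!big_split/=; apply: eq_bigr => j _.
  by have [_ ->] := dflux i j; rewrite mulrDr.
have := balance p Dp.
rewrite (thickness_integral_flux_divergence alpha_gt0 beta_ge0 h_smooth h_gt0 r_smooth r_imm X_imm W_C3 Dp).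
rewrite dsum Etop Ebottom -/trans mulNr => /eqP.
rewrite eqr_oppLR => /eqP ->.
move: (\sum_(i < 2) _) (F (h p)) (F (- h p)) => S f1 f2.
by move: (trans (point p (h p))) (trans (point p (- h p))) => t1 t2; ring.
Qed.
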